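(* The periodic+finite vertex prediction problem on $\mathbb Z^3$ is undecidable. That is, there is no algorithm (Turing machine) which, given as input a finite encoding of an arbitrary periodic+finite sandpile configuration $S_0:\mathbb Z^3\to\mathbb Z$, always halts and correctly decides whether the origin topples at least once in the sandpile process started from $S_0$, i.e. whether $N(\vec 0)\ge 1$, where $N$ is the odometer function of $S_0$.
   Context: Sandpile process. Let $\mathbb Z^3$ be the cubic lattice graph in which each vertex has six neighbours $v\pm e_i$. A configuration is a function $S_0:\mathbb Z^3\to\mathbb Z$ ($S_0(v)$ is the number of chips initially on $v$). A vertex is unstable if it currently has at least $6$ chips (its degree). Toppling a vertex removes $6$ chips from it and adds one chip to each of its six neighbours. A toppling sequence is a finite (possibly empty) or infinite sequence of vertices, toppled in order starting from $S_0$. It is legal if each vertex toppled is unstable at the moment just before it is toppled, and complete if every vertex that is unstable at some step (including the start) is toppled at some later step. The odometer function $N:\mathbb Z^3\to\mathbb Z_{\ge0}\cup\{\infty\}$ of $S_0$ is: $N(v)$ is the number of times $v$ occurs in a legal complete toppling sequence; such sequences exist and the number does not depend on which one is chosen. Periodic+finite configurations. A configuration $P:\mathbb Z^3\to\mathbb Z$ is periodic if there are integers $n_x,n_y,n_z\ge1$ such that $P(x,y,z)=P(x',y',z')$ whenever $x\equiv x' \bmod n_x$, $y\equiv y'\bmod n_y$, $z\equiv z'\bmod n_z$. A periodic+finite configuration is $S_0=P+F$ with $P$ periodic and $F:\mathbb Z^3\to\mathbb Z_{\ge0}$ of finite support (finitely many added chips). Its finite encoding consists of $n_x,n_y,n_z$,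 the values of $P$ on $\{0,\dots,n_x-1\}\times\{0,\dots,n_y-1\}\times\{0,\dots,n_z-1\}$, and the finite list of pairs $(v,F(v))$ with $F(v)\neq0$. *)

(* Defs.v *)
From mathcomp Require Import all_boot all_order all_algebra.

Set Implicit Arguments.
Unset Strict Implicit.
Unset Printing Implicit Defensive.

Import GRing.Theory Num.Theory.
Local Open Scope ring_scope.

(** * The sandpile process on the cubic lattice *)

Definition vertex : Type := (int * int * int)%type.
Definition origin : vertex := (0, 0, 0).

Definition neighbours (v : vertex) : seq vertex :=
  let: (x, y, z) := v in
  [:: (x + 1, y, z); (x - 1, y, z);
      (x, y + 1, z); (x, y - 1, z);
      (x, y, z + 1); (x, y, z - 1)].

Definition configuration : Type := vertex -> int.

Definition unstable (S : configuration) (v : vertex) : Prop := 6 <= S v.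

Definition topple (S : configuration) (v : vertex) : configuration :=
  fun u => S u - (if u == v then 6 else 0)
               + (if u \in neighbours v then 1 else 0).

Inductive toppling_sequence : Type :=
  | FinSeq of seq vertex
  | InfSeq of (nat -> vertex).

(* The vertex toppled at step k (counted from 0), or None past the end. *)
Definition toppled_at (s : toppling_sequence) (k : nat) : option vertex :=
  match s with
  | FinSeq l => onth l k
  | InfSeq f => Some (f k)
  end.

(* The configuration just before step k; past the end of a finite sequence it
   is constantly the final configuration. *)
Fixpoint config_at (S0 : configuration) (s : toppling_sequence) (k : nat)
    : configuration :=
  if k is j.+1 then
    if toppled_at s j is Some v then topple (config_at S0 s j) v
    else config_at S0 s j
  else S0.

Definition legal (S0 : configuration) (s : toppling_sequence) : Prop :=
  forall (k : nat) (v : vertex),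
    toppled_at s k = Some v -> unstable (config_at S0 s k) v.

Definition complete (S0 : configuration) (s : toppling_sequence) : Prop :=
  forall (k : nat) (v : vertex),
    unstable (config_at S0 s k) v ->
    exists2 j : nat, (k <= j)%N & toppled_at s j = Some v.

Inductive enat : Type := Fin of nat | Infty.

Definition enat_le (m n : enat) : bool :=
  match m, n with
  | _, Infty => true
  | Infty, Fin _ => false
  | Fin m, Fin n => (m <= n)%N
  end.

Definition count_before (s : toppling_sequence) (v : vertex) (k : nat) : nat :=
  count (fun j => toppled_at s j == Some v) (iota 0 k).

Definition occurs (s : toppling_sequence) (v : vertex) (n : enat) : Prop :=
  match n with
  | Fin m => exists K : nat, forall k : nat, (K <= k)%N -> count_before s v k = m
  | Infty => forall m : nat, exists k : nat, (m <= count_before s v k)%N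
  end.

(* By the abelian property exactly one N satisfies this. *)
Definition is_odometer (S0 : configuration) (N : vertex -> enat) : Prop :=
  exists s : toppling_sequence,
    [/\ legal S0 s, complete S0 s & forall v : vertex, occurs s v (N v)].

(** * Periodic+finite configurations and their finite encodings *)

Definition periodic (nx ny nz : nat) (P : configuration) : Prop :=
  [/\ (1 <= nx)%N, (1 <= ny)%N, (1 <= nz)%N &
    forall x y z x' y' z' : int,
      (x = x' %[mod nx])%Z -> (y = y' %[mod ny])%Z -> (z = z' %[mod nz])%Z ->
      P (x, y, z) = P (x', y', z')].

(* {0..nx-1} x {0..ny-1} x {0..nz-1} in lexicographic order. *)
Definition box (nx ny nz : nat) : seq vertex :=
  let range n := [seq Posz i | i <- iota 0 n] in
  [seq (xy, z) | xy <- [seq (x, y) | x <- range nx, y <- range ny],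
                 z <- range nz].

Record finite_encoding : Type := FiniteEncoding {
  period_x : nat;
  period_y : nat;
  period_z : nat;
  box_values : seq int;
  added_chips : seq (vertex * nat)
}.

(* The added chips may be listed in any order, each vertex once. *)
Definition encodes (e : finite_encoding) (S0 : configuration) : Prop :=
  exists (P : configuration) (F : vertex -> nat),
    [/\ periodic (period_x e) (period_y e) (period_z e) P,
        box_values e = map P (box (period_x e) (period_y e) (period_z e)),
        uniq (added_chips e),
        forall (v : vertex) (n : nat),
          (v, n) \in added_chips e <-> F v = n /\ n <> 0%N &
        forall v : vertex, S0 v = P v + (F v)%:Z].

(* Integers are written in signed unary and terminated by Sep.  The word of a
   valid encoding can be parsed: the first three fields give the periods, hence
   the number of box values, and the remaining fields come in groups of four.
   The choice of base does not affect decidability. *)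
Inductive letter : Type := Tally | Minus | Sep.

Definition int_word (m : int) : seq letter :=
  rcons (match m with
         | Posz n => nseq n Tally
         | Negz n => Minus :: nseq n.+1 Tally
         end) Sep.

Definition encoding_fields (e : finite_encoding) : seq int :=
  [:: (period_x e)%:Z; (period_y e)%:Z; (period_z e)%:Z]
  ++ box_values e
  ++ flatten [seq let: ((x, y, z), n) := c in [:: x; y; z; n%:Z]
             | c <- added_chips e].

Definition encoding_word (e : finite_encoding) : seq letter :=
  flatten (map int_word (encoding_fields e)).

(** * Turing machines: deterministic, one two-way infinite tape *)

Inductive direction : Type := MoveLeft | MoveRight.

Record turing_machine (A : Type) : Type := TuringMachine {
  state : finType;
  symbol : finType;
  blank : symbol;
  input : A -> symbol;
  input_inj : injective input;
  input_nonblank : forall a : A, input a != blank;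
  start : state;
  accept : state;
  reject : state;
  accept_neq_reject : accept != reject;
  transition : state -> symbol -> state * symbol * direction
}.

Section Run.

Variables (A : Type) (M : turing_machine A).

(* The tape reads rev tape_left, tape_head, tape_right, surrounded by blanks
   on both sides. *)
Record tm_config : Type := TMConfig {
  current : state M;
  tape_left : seq (symbol M);
  tape_head : symbol M;
  tape_right : seq (symbol M)
}.

Definition initial (w : seq A) : tm_config :=
  let t := map (input M) w in
  TMConfig (start M) [::] (head (blank M) t) (behead t).

Definition step (c : tm_config) : tm_config :=
  let: TMConfig q l a r := c in
  if (q == accept M) || (q == reject M) then c else
  match transition q a with
  | (q', b, MoveLeft) => TMConfig q' (behead l) (head (blank M) l) (b :: r)
  | (q', b, MoveRight) => TMConfig q' (b :: l) (head (blank M) r) (behead r)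
  end.

Definition accepts (w : seq A) : Prop :=
  exists n : nat, current (iter n step (initial w)) = accept M.

Definition rejects (w : seq A) : Prop :=
  exists n : nat, current (iter n step (initial w)) = reject M.

Definition halts (w : seq A) : Prop := accepts w \/ rejects w.

End Run.

(* M need not behave well on words that encode no configuration. *)
Definition decides_vertex_prediction (M : turing_machine letter) : Prop :=
  forall (e : finite_encoding) (S0 : configuration),
    encodes e S0 ->
    halts M (encoding_word e) /\
    (accepts M (encoding_word e) <->
     exists2 N : vertex -> enat, is_odometer S0 N & enat_le (Fin 1) (N origin)).

(* Main.v *)
(* In a complete sequence a vertex topples as soon as enough of its neighbours
   have toppled, and by the least action principle nothing else topples if the
   set of these vertices is stable.  Walls, vertices that need one toppled
   neighbour (wires) and vertices that need two (gates) thus turn a periodic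
   background into a periodic monotone circuit; two consecutive gates sharing
   two wires form a diode, so the circuit evaluates arbitrary local Horn rules
   on the cells of [Z^2].  Reading one coordinate as time and the other as
   position, Horn rules run a machine with counters and a tape: a counter is the
   position of a marker, the control state is broadcast along the whole row, and
   the tags needed for zero tests grow from a single seed at the origin.

   Given a decider [M], let the machine read a number [N] coding a word [w] and
   a number [c], print the encoding of the configuration with background [w]
   whose seeds are the inputs [N] and [c] (placed at multiples of the period
   [c]), run [M] on it, and topple the origin exactly if [M] rejects.  Taking
   for [w] the background of this very machine contradicts the correctness of
   [M]. *)

From HB Require Import structures.
From mathcomp Require Import all_boot all_order all_algebra zify boolp.
Require Import Defs.

Set Implicit Arguments.
Unset Strict Implicit.
Unset Printing Implicit Defensive.

Import Order.TTheory GRing.Theory Num.Theory.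
Local Open Scope ring_scope.

(** * Toppling sequences *)

(** Two obstacles shape the construction. The machine has to print the very background that
    implements it. No recursion theorem is invoked for this, because the background depends on the
    program only: everything specific to an input sits in three added chips, the positions of two of
    which encode the inputs. The price is that positions are written in unary, so the machine must
    multiply by the period to print them. Second, the question concerns one fixed vertex while the
    halting time is unknown; since a Horn rule may have its conclusion at an earlier time, halting
    is carried back to the origin. Wires have no orientation, so both ends of a wire carry the same
    fact and only gates separate facts. The third dimension lets wires cross: facts run vertically,
    and each rule is wired on levels of its own. Single edges are removed by giving each edge a
    midpoint, either a relay or a wall; this doubles all coordinates. *)

Lemma mem_neighbours (u v : vertex) :
  (u \in neighbours v) = (v \in neighbours u).
Proof.
suff imp w w' : w \in neighbours w' -> w' \in neighbours w.
  by apply/idP/idP; apply: imp.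
case: w w' => [[a b] c] [[x y] z]; rewrite !inE !xpair_eqE.
by case/or4P => [||| /or3P[]] /andP[/andP[/eqP-> /eqP->] /eqP->];
  rewrite ?addrK ?subrK !eqxx ?orbT.
Qed.

Lemma neighbours_uniq (v : vertex) : uniq (neighbours v).
Proof.
case: v => [[x y] z].
have E1 (p : int) : (p + 1 == p) = false by lia.
have E2 (p : int) : (p - 1 == p) = false by lia.
have E1' (p : int) : (p == p + 1) = false by lia.
have E2' (p : int) : (p == p - 1) = false by lia.
have E3 (p : int) : (p + 1 == p - 1) = false by lia.
by rewrite /= !inE !xpair_eqE !(E1, E2, E3, E1', E2') /= ?andbF.
Qed.

Lemma count_beforeS s v k :
  count_before s v k.+1 = (count_before s v k + (toppled_at s k == Some v))%N.
Proof. by rewrite /count_before -addn1 iotaD count_cat /= addn0 add0n. Qed.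

Lemma count_before_leq s v j k :
  (j <= k)%N -> (count_before s v j <= count_before s v k)%N.
Proof.
by move=> /subnKC <-; rewrite /count_before iotaD count_cat leq_addr.
Qed.

(** The number of chips depends only on how often each vertex has toppled, not on the order. Both
    the upper and the lower bound on toppling compare these counts. *)
Lemma config_atE S0 s k v :
  config_at S0 s k v =
    S0 v - 6 * (count_before s v k)%:Z
    + \sum_(u <- neighbours v) (count_before s u k)%:Z.
Proof.
elim: k => [|k IHk].
  by rewrite /= mulr0 subr0 big1 ?addr0.
rewrite count_beforeS /=.
under eq_bigr => u _ do rewrite count_beforeS.
case E: (toppled_at s k) => [w|]; last first.
  rewrite IHk /= addn0; congr (_ + _).
  by apply: eq_bigr => u _; rewrite addn0.
rewrite /topple IHk.
under eq_bigr => u _ do rewrite PoszD.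
rewrite big_split /=.
have -> : \sum_(u <- neighbours v) ((Some w == Some u) : nat)%:Z
          = (if v \in neighbours w then 1 else 0 : int).
  rewrite mem_neighbours; case: ifP => wv.
    rewrite (bigD1_seq w) ?neighbours_uniq //= eqxx big1 ?addr0 // => u uw.
    by rewrite eq_sym (inj_eq (@Some_inj _)) (negPf uw).
  rewrite big_seq big1 // => u uv.
  by case: eqP => // -[wu]; rewrite wu uv in wv.
have -> : (Some w == Some v) = (v == w) by rewrite eq_sym.
rewrite PoszD; set b := (if _ then 1 else 0); set sg := \sum_(i <- _) _.
by case: (v == w) => /=; lia.
Qed.

(* The least action principle for a stabilising function with values 0, 1. *)
Lemma legal_count_leq (S0 : configuration) (s : toppling_sequence)
    (B : vertex -> bool) :
  legal S0 s ->
  (forall v, S0 v + \sum_(u <- neighbours v) (B u : nat)%:Z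
             <= 5 + 6 * (B v : nat)%:Z) ->
  forall k v, (count_before s v k <= B v)%N.
Proof.
move=> sl stab; elim=> [|k IHk] v; first by [].
rewrite count_beforeS; case: eqP => [tv|_]; last by rewrite addn0.
have := sl k v tv; rewrite /unstable config_atE => U.
have := stab v.
have : \sum_(u <- neighbours v) (count_before s u k)%:Z
       <= \sum_(u <- neighbours v) (B u : nat)%:Z.
  by apply: ler_sum => u _; rewrite lez_nat.
have := IHk v; lia.
Qed.

Definition topples (s : toppling_sequence) (v : vertex) : Prop :=
  exists k, toppled_at s k = Some v.

Lemma topplesP s v :
  topples s v <-> exists K, forall k, (K <= k)%N -> (0 < count_before s v k)%N.
Proof.
split=> [[k tk]|[K /(_ K (leqnn K))]].
  exists k.+1 => j kj; apply: leq_trans (count_before_leq s v kj).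
  by rewrite count_beforeS tk eqxx addn1.
rewrite /count_before -has_count => /hasP[j _ /eqP tj].
by exists j.
Qed.

Lemma uniformly_eventually (T : eqType) (l : seq T) (Q : T -> nat -> Prop) :
  (forall x, x \in l -> exists K, forall k, (K <= k)%N -> Q x k) ->
  exists K, forall k x, (K <= k)%N -> x \in l -> Q x k.
Proof.
elim: l => [|y l IHl] H; first by exists 0%N.
have [|K HK] := IHl; first by move=> x xl; apply: H; rewrite inE xl orbT.
have [K' HK'] := H y (mem_head _ _).
exists (maxn K K') => k x; rewrite geq_max => /andP[h1 h2].
by rewrite inE => /orP[/eqP->|xl]; [apply: HK' | apply: HK].
Qed.

(* A vertex that never topples only accumulates chips. *)
Lemma complete_topples (S0 : configuration) s v (l : seq vertex) :
  complete S0 s -> uniq l -> {subset l <= neighbours v} ->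
  (forall u, u \in l -> topples s u) ->
  6 <= S0 v + (size l)%:Z -> topples s v.
Proof.
move=> sc lu lv lt S6; apply: contrapT => nt.
have [|K HK] := @uniformly_eventually _ l
    (fun u k => (0 < count_before s u k)%N).
  by move=> u /lt /topplesP.
have c0 : count_before s v K = 0%N.
  apply/eqP; rewrite -leqn0 leqNgt -has_count; apply/negP => /hasP[j _ /eqP tj].
  by apply: nt; exists j.
have U : unstable (config_at S0 s K) v.
  rewrite /unstable config_atE c0 mulr0 subr0 (le_trans S6) // lerD2l.
  have -> : (size l)%:Z = \sum_(u <- l) 1%:Z :> int.
    by elim: (l) => [|u l' IHl]; rewrite ?big_nil // big_cons -IHl.
  rewrite [X in _ <= X](bigID (mem l)) /= -[X in _ <= X + _]big_filter.
  have -> : \sum_(u <- [seq u <- neighbours v | u \in l])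
                (count_before s u K)%:Z
            = \sum_(u <- l) (count_before s u K)%:Z.
    apply: perm_big; apply: uniq_perm => //.
      by rewrite filter_uniq // neighbours_uniq.
    by move=> u; rewrite mem_filter; case ul: (u \in l) => //=; apply: lv.
  apply: (@le_trans _ _ (\sum_(u <- l) (count_before s u K)%:Z)).
    rewrite big_seq [X in _ <= X]big_seq.
    by apply: ler_sum => u ul; rewrite lez_nat HK.
  by rewrite lerDl sumr_ge0.
by have [j _ tj] := sc K v U; apply: nt; exists j.
Qed.

(** * Existence of legal complete sequences and of the odometer *)

Definition schedule (t : nat) : vertex :=
  odflt origin (@unpickle (int * int * int)%type (logn 2 t)).

Lemma logn_pow2_odd p k : logn 2 (2 ^ p * k.*2.+1)%N = p.
Proof.
rewrite lognM ?expn_gt0 // pfactorK // [logn 2 _.+1]lognE.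
by rewrite [(2 %| _)%N]dvdn2 /= odd_double /= addn0.
Qed.
(** Multiplying a power of two by a large odd number keeps its 2-adic valuation, so the code of each
    vertex comes up as [logn 2 t] at arbitrarily late times. *)
Lemma schedule_infinitely_often (v : vertex) (K : nat) :
  exists2 t, (K <= t)%N & schedule t = v.
Proof.
exists (2 ^ @pickle (int * int * int)%type v * K.*2.+1)%N.
  apply: (@leq_trans K.*2.+1); last by rewrite leq_pmull ?expn_gt0.
  by rewrite -addnn leqW ?leq_addr.
by rewrite /schedule logn_pow2_odd pickleK.
Qed.

(** The second component of [c] is a clock. Times whose scheduled vertex is stable are skipped,
    since a legal sequence may not topple it; whether a suitable time exists is decided
    classically. *)
Definition next_time (c : configuration * nat) : option nat :=
  if pselect (exists t, (c.2 <= t)%N && (6 <= c.1 (schedule t))) is left ex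
  then Some (ex_minn ex) else None.

Definition greedy_step (c : configuration * nat) : configuration * nat :=
  if next_time c is Some t then (topple c.1 (schedule t), t.+1) else c.

Lemma next_timeP c t : next_time c = Some t ->
  [/\ (c.2 <= t)%N, 6 <= c.1 (schedule t) &
   forall u, (c.2 <= u)%N -> 6 <= c.1 (schedule u) -> (t <= u)%N].
Proof.
rewrite /next_time; case: pselect => // ex [<-]; case: ex_minnP => m /andP[h1 h2] h3.
by split=> // u u1 u2; apply: h3; rewrite u1.
Qed.

Lemma next_time_exists c u : (c.2 <= u)%N -> 6 <= c.1 (schedule u) ->
  exists t, next_time c = Some t.
Proof.
move=> u1 u2; rewrite /next_time; case: pselect => [ex|[]]; first by eexists.
by exists u; rewrite u1.
Qed.

Lemma sequence_of_options (f : nat -> option vertex) :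
  (forall k, f k = None -> f k.+1 = None) -> exists s, toppled_at s =1 f.
Proof.
move=> fN; case: (pselect (exists k, f k == None)) => [ex|nex]; last first.
  exists (InfSeq (fun k => odflt origin (f k))) => k /=.
  by case E: (f k) => [v|] //; case: nex; exists k; rewrite E.
case: (ex_minnP ex) => K /eqP fK minK.
exists (FinSeq [seq odflt origin (f k) | k <- iota 0 K]) => k /=.
case: (ltnP k K) => kK.
  rewrite onthE (nth_map origin) ?size_map ?size_iota //.
  rewrite (nth_map 0%N) ?size_iota // nth_iota // add0n.
  by case E: (f k) => [v|] //; have := minK k; rewrite E eqxx leqNgt kK => /(_ isT).
rewrite onthE nth_default ?size_map ?size_iota //.
by rewrite -(subnKC kK); elim: (k - K)%N => [|j IHj]; rewrite ?addn0 // addnS fN.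
Qed.

Lemma topple_geq S v w : w <> v -> S v <= topple S w v.
Proof.
move=> wv; rewrite /topple; have -> : (v == w) = false by apply/eqP => e; apply: wv.
by case: ifP; lia.
Qed.

(** A vertex that is unstable and never toppled again stays unstable, since toppling others only
    adds chips to it. The clock of the greedy run would then advance forever without passing a time
    at which that vertex is scheduled. *)
Lemma legal_complete_exists (S0 : configuration) :
  exists s, legal S0 s /\ complete S0 s.
Proof.
pose run k := iter k greedy_step (S0, 0%N).
have runS k : run k.+1 = greedy_step (run k) by [].
have [|s sE] := @sequence_of_options (fun k => omap schedule (next_time (run k))).
  move=> k; case E: (next_time (run k)) => [//|] _.
  by rewrite runS /greedy_step E E.
have cE k : config_at S0 s k = (run k).1.
  elim: k => [//|k IHk]; rewrite runS /= sE IHk /greedy_step.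
  by case: (next_time _).
exists s; split=> [k v|k v U].
  rewrite sE cE; case E: next_time => [t|] //= [<-].
  by have [] := next_timeP E.
apply: contrapT => nt.
have stay j : (k <= j)%N -> unstable (config_at S0 s j) v.
  move=> /subnKC <-; elim: (j - k)%N => [|i IHi]; first by rewrite addn0.
  rewrite addnS /=; case E: (toppled_at s _) => [w|] //.
  apply: le_trans IHi _; apply: topple_geq => wv; apply: nt.
  by exists (k + i)%N; rewrite ?leq_addr // E wv.
have [T T1 T2] := schedule_infinitely_often v (run k).2.
suff bound i : ((run k).2 + i <= (run (k + i)%N).2 <= T)%N.
  by have /andP[h1 h2] := bound T.+1; lia.
elim: i => [|i /andP[IH1 IH2]]; first by rewrite !addn0 leqnn T1.
have UT : 6 <= (run (k + i)%N).1 (schedule T).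
  by rewrite T2 -cE; apply: stay; rewrite leq_addr.
have [t tE] := next_time_exists IH2 UT.
have [t1 t2 t3] := next_timeP tE.
have tT : t != T.
  apply/eqP => e; apply: nt; exists (k + i)%N; first by rewrite leq_addr.
  by rewrite sE tE e /= T2.
have := t3 T IH2 UT.
rewrite [(k + i.+1)%N]addnS runS /greedy_step tE /=; lia.
Qed.

(** Counts grow with [k], so a bounded count reaches its maximum and stays there. *)
Lemma occurs_exists s v : exists n, occurs s v n.
Proof.
case: (pselect (forall m, exists k, (m <= count_before s v k)%N)) => [h|].
  by exists Infty.
move=> /existsNP[m hm].
have bd k : (count_before s v k < m)%N.
  by rewrite ltnNge; apply/negP => mk; apply: hm; exists k.
have ex : exists i, `[< exists k, count_before s v k = i >].
  by exists (count_before s v 0); apply/asboolP; exists 0%N.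
have ub i : `[< exists k, count_before s v k = i >] -> (i <= m)%N.
  by move=> /asboolP[k <-]; apply: ltnW.
case: (ex_maxnP ex ub) => i /asboolP[K Ki] imax.
exists (Fin i), K => k Kk; apply/eqP; rewrite eqn_leq imax; last first.
  by apply/asboolP; exists k.
by rewrite -Ki count_before_leq.
Qed.

Lemma prediction_topples (S0 : configuration) v :
  (exists2 N, is_odometer S0 N & enat_le (Fin 1) (N v)) <->
  (exists s, [/\ legal S0 s, complete S0 s & topples s v]).
Proof.
split=> [[N [s [sl sc sN] Nv]]|[s [sl sc st]]].
  exists s; split=> //; apply/topplesP.
  case: (N v) (sN v) Nv => [m [K HK] m1|h _].
    by exists K => k Kk; rewrite HK.
  have [K HK] := h 1%N; exists K => k Kk.
  exact: leq_trans HK (count_before_leq s v Kk).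
have [N HN] := choice (occurs_exists s); exists N; first by exists s.
case: (N v) (HN v) => [m [K HK]|//].
have /topplesP[K' HK'] := st.
by rewrite /= -(HK (maxn K K')) ?leq_maxl // HK' ?leq_maxr.
Qed.

Lemma topples_prediction (S0 : configuration) v :
  (forall s, complete S0 s -> topples s v) ->
  exists2 N, is_odometer S0 N & enat_le (Fin 1) (N v).
Proof.
move=> h; apply/prediction_topples.
have [s [sl sc]] := legal_complete_exists S0.
by exists s; split=> //; apply: h.
Qed.

(** * Threshold networks on the cubic lattice *)

(* [link_x v] says whether the lattice edge from [v] to [v + e_x] is present. *)
Record network := Network {
  link_x : vertex -> bool;
  link_y : vertex -> bool;
  link_z : vertex -> bool;
  threshold : vertex -> nat
}.

Definition at_node (v : vertex) : vertex :=
  let: (a, b, c) := v in (a * 2, b * 2, c * 2).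

(** An entry gives the presence of the edge, its midpoint in coordinates of the subdivided lattice,
    and the node at its other end in coordinates of the network. *)
Definition links (g : network) (v : vertex) : seq (bool * vertex * vertex) :=
  let: (a, b, c) := v in
  [:: (link_x g v, (a * 2 + 1, b * 2, c * 2), (a + 1, b, c));
      (link_x g (a - 1, b, c), (a * 2 - 1, b * 2, c * 2), (a - 1, b, c));
      (link_y g v, (a * 2, b * 2 + 1, c * 2), (a, b + 1, c));
      (link_y g (a, b - 1, c), (a * 2, b * 2 - 1, c * 2), (a, b - 1, c));
      (link_z g v, (a * 2, b * 2, c * 2 + 1), (a, b, c + 1));
      (link_z g (a, b, c - 1), (a * 2, b * 2, c * 2 - 1), (a, b, c - 1))].

Definition subdivide (T : Type) (node mid_x mid_y mid_z : vertex -> T) (wall : T)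
    (v : vertex) : T :=
  let: (x, y, z) := v in
  let h := ((x %/ 2)%Z, (y %/ 2)%Z, (z %/ 2)%Z) in
  match (x %% 2)%Z == 0, (y %% 2)%Z == 0, (z %% 2)%Z == 0 with
  | true, true, true => node h
  | false, true, true => mid_x h
  | true, false, true => mid_y h
  | true, true, false => mid_z h
  | _, _, _ => wall
  end.

(* The vertices with even coordinates are the nodes and those with exactly one
   odd coordinate are the midpoints of lattice edges.  A wall has [-1] chips and
   stays stable even when all its neighbours topple. *)
Definition network_config (g : network) : configuration :=
  let mid (b : bool) : int := if b then 5 else - 1 in
  subdivide (fun v => 6 - (threshold g v)%:Z) (fun v => mid (link_x g v))
    (fun v => mid (link_y g v)) (fun v => mid (link_z g v)) (- 1).

(** [B] is the set of fired nodes; a relay starts with 5 chips and fires as soon as either of its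
    ends does. *)
Definition network_fired (g : network) (B : vertex -> bool) : vertex -> bool :=
  subdivide B
    (fun v => link_x g v && (B v || B (let: (a, b, c) := v in (a + 1, b, c))))
    (fun v => link_y g v && (B v || B (let: (a, b, c) := v in (a, b + 1, c))))
    (fun v => link_z g v && (B v || B (let: (a, b, c) := v in (a, b, c + 1))))
    false.

Lemma half_even (a : int) : (a * 2 %% 2)%Z = 0 /\ (a * 2 %/ 2)%Z = a.
Proof. by split; lia. Qed.

Lemma half_odd (a : int) :
  (((a * 2 + 1) %% 2)%Z == 0) = false /\ ((a * 2 + 1) %/ 2)%Z = a.
Proof. by split; lia. Qed.

Lemma odd_pred (a : int) : a * 2 - 1 = (a - 1) * 2 + 1.
Proof. lia. Qed.

Lemma odd_succ (a : int) : a * 2 + 1 + 1 = (a + 1) * 2.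
Proof. lia. Qed.

Lemma parityP (x : int) : exists a, x = a * 2 \/ x = a * 2 + 1.
Proof. by exists (x %/ 2)%Z; lia. Qed.

Ltac subdivide_eval :=
  rewrite /network_config /network_fired /subdivide /at_node /fst /snd
    ?odd_succ ?addrK ?odd_pred ?(proj1 (half_even _)) ?(proj2 (half_even _))
    ?(proj1 (half_odd _)) ?(proj2 (half_odd _)) ?eqxx ?subrK.

Lemma network_config_node g v :
  network_config g (at_node v) = 6 - (threshold g v)%:Z.
Proof. by case: v => [[a b] c]; subdivide_eval. Qed.

Lemma network_fired_node g B v : network_fired g B (at_node v) = B v.
Proof. by case: v => [[a b] c]; subdivide_eval. Qed.

Lemma network_config_mid g v p :
  p \in links g v -> network_config g p.1.2 = if p.1.1 then 5 else - 1.
Proof.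
case: v => [[a b] c]; rewrite !inE.
by case/or4P => [||| /or3P[]] /eqP->; subdivide_eval.
Qed.

Lemma network_fired_mid g B v p :
  p \in links g v -> network_fired g B p.1.2 = p.1.1 && (B v || B p.2).
Proof.
case: v => [[a b] c]; rewrite !inE.
by case/or4P => [||| /or3P[]] /eqP->; subdivide_eval; rewrite /= 1?[B _ || _]orbC.
Qed.

Lemma neighbours_at_node g v :
  neighbours (at_node v) = [seq p.1.2 | p <- links g v].
Proof. by case: v => [[a b] c]. Qed.

Lemma sum_neighbours_leq6 (f : vertex -> bool) v :
  \sum_(u <- neighbours v) (f u : nat)%:Z <= 6.
Proof.
apply: (@le_trans _ _ (\sum_(u <- neighbours v) 1%:Z)).
  by apply: ler_sum => u _; case: f.
by rewrite big_const_seq count_predT; case: v => [[a b] c].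
Qed.

Lemma network_stable (g : network) (seed B : vertex -> bool) (S0 : configuration) :
  (forall v, S0 (at_node v) = network_config g (at_node v) + (seed v : nat)%:Z) ->
  (forall v, (forall u, v <> at_node u) -> S0 v = network_config g v) ->
  (forall v, seed v -> B v) ->
  (forall v, (1 <= threshold g v)%N) ->
  (forall v, ~~ B v ->
     (count (fun p => p.1.1 && B p.2) (links g v) < threshold g v)%N) ->
  (forall v, seed v -> ~~ all (fun p => p.1.1) (links g v)) ->
  forall v, S0 v + \sum_(u <- neighbours v) (network_fired g B u : nat)%:Z
            <= 5 + 6 * (network_fired g B v : nat)%:Z.
Proof.
move=> S0node S0other seedB th1 closed seedfree v.
have le6 := sum_neighbours_leq6 (network_fired g B) v.
case: (pselect (exists u, v = at_node u)) => [[u vu]|nv].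
  rewrite vu S0node network_config_node network_fired_node.
  rewrite vu (neighbours_at_node g) big_map in le6 *.
  set sum := \sum_(j <- _) _ in le6 *; have th1u := th1 u.
  case Bu: (B u).
    (* A fired node may hold at most 11 chips in the inequality. It starts with at most 5, or 6 if
       it is a seed, so a seed needs a neighbour that never fires: the midpoint of a missing
       link. *)
    suff: (seed u : nat)%:Z + sum <= 6 by lia.
    case su: (seed u); last by rewrite add0r.
    have /allPn[p pu np] := seedfree u su.
    rewrite -[6]/(1%:Z + 5) lerD2l /sum (big_rem p pu) /=.
    rewrite (network_fired_mid _ pu) (negPf np) /= add0r.
    apply: (@le_trans _ _ (\sum_(q <- rem p (links g u)) 1%:Z)).
      by apply: ler_sum => q _; case: network_fired.
    rewrite big_const_seq count_predT size_rem //.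
    by case: (u) => [[? ?] ?].
  have su : seed u = false by apply: contraFF Bu => /seedB.
  have := closed u (negbT Bu).
  have -> : sum = (count (fun p => p.1.1 && B p.2) (links g u))%:Z.
    rewrite /sum -sum1_count raddf_sum [RHS]big_mkcond /= big_seq [RHS]big_seq.
    apply: eq_bigr => q qu; rewrite (network_fired_mid _ qu) Bu /=.
    by case: ifP.
  rewrite su; lia.
rewrite S0other; last by move=> u vu; apply: nv; exists u.
suff : network_config g v <= -1 \/ network_config g v = 5 /\
    \sum_(u <- neighbours v) (network_fired g B u : nat)%:Z
     <= 6 * (network_fired g B v : nat)%:Z by lia.
case: v nv {le6} => [[x y] z] nv.
have [a ax] := parityP x; have [b bx] := parityP y; have [c cx] := parityP z.
case: ax nv => ->; case: bx => ->; case: cx => -> nv;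
  try (by left; subdivide_eval).
- by case: nv; exists (a, b, c).
- rewrite (_ : network_config _ _ = if link_z g (a, b, c) then 5 else -1);
    last by subdivide_eval.
  case E: (link_z g (a, b, c)); [right; split=> // | by left].
  rewrite !big_cons big_nil; subdivide_eval.
  by rewrite E /=; case: (B _); case: (B _).
- rewrite (_ : network_config _ _ = if link_y g (a, b, c) then 5 else -1);
    last by subdivide_eval.
  case E: (link_y g (a, b, c)); [right; split=> // | by left].
  rewrite !big_cons big_nil; subdivide_eval.
  by rewrite E /=; case: (B _); case: (B _).
- rewrite (_ : network_config _ _ = if link_x g (a, b, c) then 5 else -1);
    last by subdivide_eval.
  case E: (link_x g (a, b, c)); [right; split=> // | by left].
  rewrite !big_cons big_nil; subdivide_eval.
  by rewrite E /=; case: (B _); case: (B _).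
Qed.

Lemma odd_pred2 (a : int) : a * 2 - 1 - 1 = (a - 1) * 2.
Proof. lia. Qed.

(** Each link of [l] leads to a node that topples and thereby topples the midpoint; distinct
    midpoints deliver one chip each to [v]. *)
Lemma network_topples (g : network) (S0 : configuration) s v
    (l : seq (bool * vertex * vertex)) :
  complete S0 s -> (forall u, network_config g u <= S0 u) ->
  uniq [seq p.1.2 | p <- l] -> {subset l <= links g v} ->
  (forall p, p \in l -> p.1.1 /\ topples s (at_node p.2)) ->
  6 <= S0 (at_node v) + (size l)%:Z ->
  topples s (at_node v).
Proof.
move=> sc gS ul lv lt S6.
apply: (complete_topples (l := [seq p.1.2 | p <- l]) sc ul);
  last by rewrite size_map.
- move=> w /mapP[p /lv pv ->]; rewrite (neighbours_at_node g).
  exact: (map_f (fun r : bool * vertex * vertex => r.1.2)).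
- move=> w /mapP[p pl ->]; have [p1 tp] := lt p pl.
  apply: (complete_topples (l := [:: at_node p.2]) sc) => //=.
  + move=> u; rewrite inE => /eqP->; have /lv := pl; case: v {lv S6} => [[a b] c].
    rewrite !inE; case/or4P => [||| /or3P[]] /eqP->;
    by rewrite /at_node /= !inE !xpair_eqE ?odd_succ ?odd_pred2 !eqxx ?orbT.
  + by move=> u; rewrite inE => /eqP->.
  + have := gS p.1.2; rewrite (network_config_mid (lv _ pl)) p1.
    by rewrite (_ : 6 = 5 + 1) ?lerD2r.
Qed.

(** * Circuits for Horn rules on the square lattice *)

(** Column [a] of cell [x], for cells of width [d]. The value [a = d] is used too and means column 0
    of the next cell, which lets paths cross cell borders. *)
Definition pos (d : nat) (x : int) (a : nat) : int := x * d%:Z + a%:Z.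
Definition residue (d : nat) (X : int) : nat := absz (X %% d%:Z)%Z.
Definition cell (d : nat) (X : int) : int := (X %/ d%:Z)%Z.

Lemma residue_pos d x a : (a < d)%N -> residue d (pos d x a) = a.
Proof.
by move=> ad; rewrite /residue /pos modzMDl modz_nat modn_small.
Qed.

Lemma cell_pos d x a : (a < d)%N -> cell d (pos d x a) = x.
Proof.
move=> ad; rewrite /cell /pos divzMDl; last by lia.
by rewrite divz_nat divn_small // addr0.
Qed.

Lemma pos_split d X : (0 < d)%N ->
  exists x a, (a < d)%N /\ X = pos d x a.
Proof.
move=> d0; exists (cell d X), (residue d X).
have m0 : 0 <= (X %% d%:Z)%Z by apply: modz_ge0; lia.
split; last by rewrite /pos /residue gez0_abs // -divz_eq.
by rewrite -ltz_nat /residue gez0_abs // ltz_pmod.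
Qed.

Lemma pos_next d x a : pos d x a + 1 = pos d x a.+1.
Proof. rewrite /pos; lia. Qed.

Lemma pos_pred d x a : pos d x a.+1 - 1 = pos d x a.
Proof. rewrite /pos; lia. Qed.

Lemma pos_wrap d x : pos d x d = pos d (x + 1) 0.
Proof. rewrite /pos; lia. Qed.

(* A rule of a Horn system on the cells of [Z^2]: [src1] and [src2] at the cell
   [c + (sx, sy)] imply [dst] at [c + (dx, dy)], for every cell [c]. *)
Record rule := Rule {
  src1 : nat; src2 : nat; dst : nat;
  sx : bool; sy : bool; dx : bool; dy : bool
}.

Definition rule_fields (r : rule) :=
  (src1 r, src2 r, dst r, (sx r, sy r, dx r, dy r)).

Lemma rule_fields_inj : injective rule_fields.
Proof. by case=> ? ? ? ? ? ? ?; case=> ? ? ? ? ? ? ? [-> -> -> -> -> -> ->]. Qed.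

HB.instance Definition _ := Equality.copy rule (inj_type rule_fields_inj).

Definition shift (b : bool) (x : int) : int := x + (b : nat)%:Z.

(** Indexed by the level that carries the source: 0 for the first, 2 for the second. *)
Definition src (k : nat) (r : rule) := if eqn k 0 then src1 r else src2 r.

Definition premises (D : nat -> int -> int -> Prop) (r : rule) (x y : int) :=
  D (src1 r) (shift (sx r) x) (shift (sy r) y) /\
  D (src2 r) (shift (sx r) x) (shift (sy r) y).

Definition sound (D : nat -> int -> int -> Prop) (r : rule) :=
  forall x y, premises D r x y -> D (dst r) (shift (dx r) x) (shift (dy r) y).

Definition well_formed (n : nat) (r : rule) : bool :=
  [&& src1 r < n, src2 r < n & dst r < n]%N.

(* Net [t] runs along the vertical line at column [a = t], row [b = 0].  Each
   rule occupies three levels [k].  On levels 0 and 2 its sources are routed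
   along row 1 to column [n]; on level 1 they meet in a gate at [(n, 1)], from
   which the wires [(n + 1, 1)] and [(n, 2)] lead to a second gate at
   [(n + 1, 2)] that no signal passes backwards; its output returns along row 3.
   A wire with offset [sx] or [dx] (resp. [sy] or [dy]) goes around through the
   next cell in the [x] (resp. [y]) direction. *)
Section Layout.

Variable n : nat.

Section Local.

Variables (r : rule) (k a b : nat).

Definition local_link_x : bool :=
  if eqn k 1 then
    if eqn b 3 then
      if dx r then (a < dst r)%N || (a == n.+1) else (dst r <= a <= n)%N
    else ~~ eqn b 0 && (a == n)
  else
    (eqn b 1) &&
    (if sx r then (a < src k r)%N || (n <= a)%N else (src k r <= a < n)%N).

Definition local_link_y : bool :=
  if eqn k 1 then
    if (n <= a)%N then (eqn b 1) || (a == n.+1) && (eqn b 2)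
    else (a == dst r) && (if dy r then eqn b 3 else ~~ eqn b 3)
  else (a == src k r) && (if sy r then ~~ eqn b 0 else eqn b 0).

Definition local_link_z : bool :=
  if eqn b 0 then (a < n)%N else [&& eqn b 1, a == n & ~~ eqn k 2].

Definition local_threshold : nat :=
  if (eqn k 1) && ((a == n) && (eqn b 1) || (a == n.+1) && (eqn b 2)) then 2 else 1.

(** The nodes allowed to fire when [D] is the set of true facts. The gates and the wires between
    them carry the conjunction of the premises, a routed wire its source or destination. On a wire
    that crosses a cell border in the x direction, [n <= a] tells which of the two cells the fact
    belongs to. *)
Definition local_on (D : nat -> int -> int -> Prop) (x y : int) : Prop :=
  if eqn b 0 then D a x y
  else if eqn k 1 then
    if eqn b 3 then D (dst r) (shift (dx r && (n <= a)%N) x) (shift (dy r) y)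
    else if (n <= a)%N then premises D r x y
    else D (dst r) x y
  else
    if eqn b 1 then D (src k r) (shift (sx r && (n <= a)%N) x) (shift (sy r) y)
    else D (src k r) x (shift true y).

End Local.

Lemma shift0 x : shift false x = x. Proof. exact: addr0. Qed.

Lemma shift1 x : shift true x = x + 1. Proof. by []. Qed.

Variables (r : rule) (wf : well_formed n r) (D : nat -> int -> int -> Prop).

Lemma src_lt k : (src k r < n)%N.
Proof. by rewrite /src; case/and3P: wf; case: ifP. Qed.

Lemma dst_lt : (dst r < n)%N.
Proof. by case/and3P: wf. Qed.

Lemma local_on_x k a b x y : (a < n.+1)%N -> local_link_x r k a b ->
  local_on r k a b D x y <-> local_on r k a.+1 b D x y.
Proof.
have s1 := src_lt k; have d1 := dst_lt.
rewrite /local_link_x /local_on => an.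
case: (eqn k 1); case: b => [|[|[|[|b]]]] //=.
- by move=> /eqP->; rewrite leqnn leqnSn.
- by move=> /eqP->; rewrite leqnn leqnSn.
- case: (dx r) => //= l; rewrite (_ : (n <= a)%N = (n <= a.+1)%N) //; lia.
- by move=> /eqP->; rewrite leqnn leqnSn.
- case: (sx r) => //= l; rewrite (_ : (n <= a)%N = (n <= a.+1)%N) //; lia.
Qed.

Lemma local_on_x_wrap k b x y : local_link_x r k n.+1 b ->
  local_on r k n.+1 b D x y <-> local_on r k 0 b D (x + 1) y.
Proof.
have s1 := src_lt k; have d1 := dst_lt.
rewrite /local_link_x /local_on.
have n0 : (n <= 0)%N = false by lia.
case: (eqn k 1); case: b => [|[|[|[|b]]]] //=; rewrite ?n0 ?leqnSn; try lia.
- by case: (dx r) => //= h; [rewrite shift0 shift1 | lia].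
- by case: (sx r) => //= h; [rewrite shift0 shift1 | lia].
Qed.

(** The ends of such a link carry the same fact, except for the link from the second gate to the
    output row. Upwards this one is the soundness of the rule; downwards it enters a gate, hence the
    restriction of each direction to targets of threshold 1. *)
Lemma local_on_y k a b x y : sound D r -> (b < 3)%N -> local_link_y r k a b ->
  (local_threshold k a b.+1 = 1%N ->
     local_on r k a b D x y -> local_on r k a b.+1 D x y) /\
  (local_threshold k a b = 1%N ->
     local_on r k a b.+1 D x y -> local_on r k a b D x y).
Proof.
move=> sD; have s1 := src_lt k; have d1 := dst_lt.
rewrite /local_link_y /local_on /local_threshold.
case: (eqn k 1); case: b => [|[|[|b]]] //= _; case: (leqP n a) => na /=;
  rewrite ?andbF ?andbT ?orbF //=.
- by case/andP=> /eqP->.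
- by move=> /eqP->; rewrite eqxx; split=> // _; apply: sD.
- by case/andP=> /eqP->; case: (dy r) => // _; rewrite !shift0.
- by case/andP=> /eqP e; lia.
- by case/andP=> /eqP->; case: (sy r) => // _; rewrite !shift0.
- by case/andP=> /eqP e; lia.
- by case/andP=> _; case: (sy r) => // _; rewrite !shift0.
Qed.

Lemma local_on_y_wrap k a x y : (a < n.+2)%N -> local_link_y r k a 3 ->
  local_on r k a 3 D x y <-> local_on r k a 0 D x (y + 1).
Proof.
have s1 := src_lt k; have d1 := dst_lt.
rewrite /local_link_y /local_on /= => an.
case: (eqn k 1); last first.
  by case/andP=> /eqP->.
case: (leqP n a) => na; first by rewrite andbF.
by case/andP=> /eqP->; case: (dy r) => // _; rewrite andbF shift0.
Qed.

(** One source does not yield both premises, but the node it enters is a gate; from the gate back,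
    both premises yield each source. *)
Lemma local_on_z k a b x y : (0 < b)%N -> local_link_z k a b ->
  (local_threshold k.+1 a b = 1%N ->
     local_on r k a b D x y -> local_on r k.+1 a b D x y) /\
  (local_threshold k a b = 1%N ->
     local_on r k.+1 a b D x y -> local_on r k a b D x y).
Proof.
rewrite /local_link_z /local_on /local_threshold.
case: b => //= b _ /and3P[/eqP-> /eqP->]; case: k => [|[|[|k]]] //= _.
  by rewrite eqxx leqnn /=; split=> // _ []; rewrite andbT.
by rewrite eqxx leqnn /=; split=> // _ []; rewrite andbT.
Qed.

End Layout.

Definition rule0 : rule := Rule 0 0 0 false false false false.

Section Network.

Variables (n : nat) (rs : seq rule).

Definition height : nat := (3 * size rs)%N.
Definition rule_at (Z : int) : rule := nth rule0 rs (residue height Z %/ 3).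
Definition level_at (Z : int) : nat := (residue height Z %% 3)%N.

Definition layout : network := Network
  (fun v => let: (X, Y, Z) := v in
     local_link_x n (rule_at Z) (level_at Z) (residue n.+2 X) (residue 4 Y))
  (fun v => let: (X, Y, Z) := v in
     local_link_y n (rule_at Z) (level_at Z) (residue n.+2 X) (residue 4 Y))
  (fun v => let: (X, Y, Z) := v in
     local_link_z n (level_at Z) (residue n.+2 X) (residue 4 Y))
  (fun v => let: (X, Y, Z) := v in
     local_threshold n (level_at Z) (residue n.+2 X) (residue 4 Y)).

Hypothesis rs_gt0 : (0 < size rs)%N.

Lemma height_gt0 : (0 < height)%N.
Proof. by rewrite muln_gt0. Qed.

Lemma residue_lt d X : (0 < d)%N -> (residue d X < d)%N.
Proof. by move=> /(pos_split X)[x [a [ad ->]]]; rewrite residue_pos. Qed.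

Lemma rule_at_in Z : rule_at Z \in rs.
Proof.
apply: mem_nth; rewrite ltn_divLR //.
by have := residue_lt Z height_gt0; rewrite /height mulnC.
Qed.

Lemma level_lt3 Z : (level_at Z < 3)%N.
Proof. by rewrite ltn_mod. Qed.

Lemma level_next Z : (level_at Z < 2)%N ->
  rule_at (Z + 1) = rule_at Z /\ level_at (Z + 1) = (level_at Z).+1.
Proof.
rewrite /rule_at /level_at.
have [z [h [hh ->]]] := pos_split Z height_gt0.
rewrite pos_next residue_pos // => k2.
have h1 : (h.+1 < height)%N by move: hh; rewrite /height; lia.
rewrite residue_pos //; split; last by lia.
congr nth; lia.
Qed.

(** * Upper bound: no node fires beyond the true facts *)

Section Soundness.

Hypothesis wf : forall r, r \in rs -> well_formed n r.

Variable D : nat -> int -> int -> Prop.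

Hypothesis rules_sound : forall r, r \in rs -> sound D r.

Definition on (v : vertex) : Prop :=
  let: (X, Y, Z) := v in
  local_on n (rule_at Z) (level_at Z) (residue n.+2 X) (residue 4 Y) D
    (cell n.+2 X) (cell 4 Y).

Arguments on : simpl never.

Lemma on_link_x X Y Z : link_x layout (X, Y, Z) ->
  on (X, Y, Z) <-> on (X + 1, Y, Z).
Proof.
have wfZ := wf (rule_at_in Z); rewrite /on /=.
have [x [a [an ->]]] := pos_split X (ltn0Sn n.+1).
rewrite pos_next residue_pos // cell_pos // => l.
move: an; rewrite ltnS leq_eqVlt => /orP[/eqP aE|an].
  rewrite aE in l *; rewrite pos_wrap residue_pos // cell_pos //.
  exact: local_on_x_wrap.
by rewrite residue_pos // cell_pos //; apply: local_on_x.
Qed.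

Lemma on_link_y X Y Z : link_y layout (X, Y, Z) ->
  (threshold layout (X, Y + 1, Z) = 1%N -> on (X, Y, Z) -> on (X, Y + 1, Z)) /\
  (threshold layout (X, Y, Z) = 1%N -> on (X, Y + 1, Z) -> on (X, Y, Z)).
Proof.
have wfZ := wf (rule_at_in Z); rewrite /on /=.
have Xn := residue_lt X (ltn0Sn n.+1).
have [y [b [b4 ->]]] := pos_split Y (ltn0Sn 3).
rewrite pos_next residue_pos // cell_pos // => l.
move: b4; rewrite ltnS leq_eqVlt => /orP[/eqP bE|b3].
  rewrite bE in l *; rewrite pos_wrap residue_pos // cell_pos //.
  by have [] := local_on_y_wrap wfZ D (cell n.+2 X) y Xn l.
rewrite residue_pos // cell_pos //; apply: local_on_y => //.
exact/rules_sound/rule_at_in.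
Qed.

Lemma on_link_z X Y Z : link_z layout (X, Y, Z) ->
  (threshold layout (X, Y, Z + 1) = 1%N -> on (X, Y, Z) -> on (X, Y, Z + 1)) /\
  (threshold layout (X, Y, Z) = 1%N -> on (X, Y, Z + 1) -> on (X, Y, Z)).
Proof.
rewrite /on /=; case: (residue 4 Y) => [|b] //= l.
have [|-> ->] := @level_next Z; last exact: local_on_z.
move: l; rewrite /local_link_z /=; have := level_lt3 Z.
by case: level_at => [|[|[]]] //; rewrite !andbF.
Qed.

Lemma on_of_link v p : threshold layout v = 1%N -> p \in links layout v ->
  p.1.1 -> on p.2 -> on v.
Proof.
case: v => [[X Y] Z] th; rewrite !inE.
case/or4P => [||| /or3P[]] /eqP->; rewrite [_.1.1]/= [_.2]/= => l o.
- exact/(on_link_x l).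
- by rewrite -[X](subrK 1); apply/(on_link_x l).
- by have [_] := on_link_y l; apply.
- by rewrite -[Y](subrK 1); have [h _] := on_link_y l; apply: h; rewrite ?subrK.
- by have [_] := on_link_z l; apply.
- by rewrite -[Z](subrK 1); have [h _] := on_link_z l; apply: h; rewrite ?subrK.
Qed.

(** This is the diode. If the premises fail, the wires between the gates are silent. The first gate
    then sees at most one active source, and the second sees at most the output row, which is a
    single link. *)
Lemma on_of_two_links v : threshold layout v != 1%N ->
  (2 <= count (fun p => p.1.1 && `[< on p.2 >]) (links layout v))%N -> on v.
Proof.
case: v => [[X Y] Z].
have -> : threshold layout (X, Y, Z) =
  local_threshold n (level_at Z) (residue n.+2 X) (residue 4 Y) by [].
rewrite /local_threshold; case: ifP => // /andP[/eqnP k1 ab] _.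
have wfZ := wf (rule_at_in Z); have d1 := dst_lt wfZ.
have [x [a [an XE]]] := pos_split X (ltn0Sn n.+1).
have [y [b [b4 YE]]] := pos_split Y (ltn0Sn 3).
rewrite XE YE !residue_pos // in ab.
case: (pselect (premises D (rule_at Z) x y)) => [h _|h].
  by rewrite /on /local_on XE YE !residue_pos // !cell_pos // k1 /=;
     case/orP: ab => /andP[/eqP-> /eqnP->] /=; rewrite ?leqnn ?leqnSn.
have offD (c : bool) w : ~ on w -> c && `[< on w >] = false.
  by move=> nw; rewrite (asboolF nw) andbF.
have n_gt0 : (0 < n)%N by apply: leq_ltn_trans d1.
case/orP: ab => /andP[/eqP aE /eqnP bE]; rewrite {}aE {}bE /= in XE YE *.
- have gateX : ~ on (X + 1, Y, Z).
    rewrite /on /local_on XE YE pos_next !residue_pos // !cell_pos // k1 /=.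
    by rewrite leqnSn.
  have gateY : ~ on (X, Y + 1, Z).
    rewrite /on /local_on XE YE pos_next !residue_pos // !cell_pos // k1 /=.
    by rewrite leqnn.
  rewrite (offD _ _ gateX) (offD _ _ gateY).
  have -> : residue n.+2 (X - 1) = n.-1.
    by rewrite XE -(prednK n_gt0) pos_pred residue_pos //; lia.
  have -> : residue 4 (Y - 1) = 0%N.
    by rewrite YE pos_pred residue_pos.
  rewrite XE YE !residue_pos // k1 /local_link_x /local_link_y /= leqnn andbF.
  rewrite (_ : n.-1 == n = false) /=; last by lia.
  case: andP => [[_ /asboolP o2]|_]; last by rewrite !add0n addn0; case: andP.
  case: andP => [[l0 /asboolP o1] _|]; last by [].
  (* Both vertical links are active; they come from levels 0 and 2 of the same rule and give its two
     premises. *)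
  case: h; split.
    have l2 : (level_at (Z - 1) < 2)%N.
      move: l0; rewrite /local_link_z /= => /andP[_].
      by have := level_lt3 (Z - 1); case: level_at => [|[|[]]].
    have [] := level_next l2; rewrite subrK k1 => rE [/esym k0].
    move: o1; rewrite -XE -YE /on XE YE /local_on !residue_pos // !cell_pos //.
    by rewrite k0 /= leqnn andbT rE.
  have [|rE k2] := @level_next Z; first by rewrite k1.
  move: o2; rewrite -XE -YE /on XE YE /local_on !residue_pos // !cell_pos //.
  by rewrite k2 k1 /= leqnn andbT rE.
- have gateX : ~ on (X - 1, Y, Z).
    rewrite /on /local_on XE YE pos_pred !residue_pos // !cell_pos // k1 /=.
    by rewrite leqnn.
  have gateY : ~ on (X, Y - 1, Z).
    rewrite /on /local_on XE YE pos_pred !residue_pos // !cell_pos // k1 /=.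
    by rewrite leqnSn.
  rewrite (offD _ _ gateX) (offD _ _ gateY) XE YE !residue_pos // k1.
  rewrite /local_link_x /local_link_z /= (_ : n.+1 == n = false) /=; last by lia.
  by case: andP.
Qed.

Lemma layout_closed v : ~~ `[< on v >] ->
  (count (fun p => p.1.1 && `[< on p.2 >]) (links layout v) < threshold layout v)%N.
Proof.
move=> /asboolPn nv; case: (eqVneq (threshold layout v) 1%N) => [t1|t2].
  rewrite t1 ltnS leqn0 -leqn0 leqNgt -has_count; apply/hasPn => p pv.
  by apply/negP => /andP[p1 /asboolP op]; apply: nv; apply: on_of_link pv p1 op.
have -> : threshold layout v = 2.
  by case: v t2 {nv} => [[X Y] Z] /=; rewrite /local_threshold; case: ifP.
by rewrite ltnNge; apply/negP => c2; apply: nv; apply: on_of_two_links.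
Qed.

Lemma layout_stays (S0 : configuration) (seed : vertex -> bool) s v :
  (forall u, S0 (at_node u) = network_config layout (at_node u) + (seed u : nat)%:Z) ->
  (forall u, (forall w, u <> at_node w) -> S0 u = network_config layout u) ->
  (forall u, seed u -> exists t x y Z,
     [/\ (t < n)%N, u = (pos n.+2 x t, pos 4 y 0, Z) & D t x y]) ->
  legal S0 s -> topples s (at_node v) -> on v.
Proof.
move=> S0node S0other seedE sl.
have seed_on u : seed u -> `[< on u >].
  move=> /seedE[t [x [y [Z [tn -> Dt]]]]]; apply/asboolP.
  rewrite /on /local_on !residue_pos ?cell_pos //; lia.
have th1 u : (1 <= threshold layout u)%N.
  by case: u => [[X Y] Z] /=; rewrite /local_threshold; case: ifP.
(* Seeds lie in row 0, which has no links in the x direction; this is the free side a seed needs. *)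
have free u : seed u -> ~~ all (fun p => p.1.1) (links layout u).
  move=> /seedE[t [x [y [Z [tn -> _]]]]].
  rewrite /= !residue_pos //; last by lia.
  by rewrite /local_link_x /=; case: eqn.
have st := network_stable S0node S0other seed_on th1 layout_closed free.
move=> [k tk]; have := legal_count_leq sl st k.+1 (at_node v).
rewrite network_fired_node count_beforeS tk eqxx addn1.
by case: asboolP.
Qed.

End Soundness.
End Network.

(** * Lower bound: derivable facts fire *)

Inductive derives (rs : seq rule) (seed : nat -> int -> int -> Prop) :
    nat -> int -> int -> Prop :=
  | DerivesSeed t x y : seed t x y -> derives rs seed t x y
  | DerivesRule r x y : r \in rs ->
      derives rs seed (src1 r) (shift (sx r) x) (shift (sy r) y) ->
      derives rs seed (src2 r) (shift (sx r) x) (shift (sy r) y) ->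
      derives rs seed (dst r) (shift (dx r) x) (shift (dy r) y).

Section Firing.

Variables (n : nat) (rs : seq rule).
Hypothesis rs_gt0 : (0 < size rs)%N.
Hypothesis wf : forall r, r \in rs -> well_formed n r.

Variables (S0 : configuration) (s : toppling_sequence).
Hypothesis s_complete : complete S0 s.
Hypothesis S0_ge : forall u, network_config (layout n rs) u <= S0 u.

Let fires (v : vertex) : Prop := topples s (at_node v).

Lemma fires_of_link v p : threshold (layout n rs) v = 1%N ->
  p \in links (layout n rs) v -> p.1.1 -> fires p.2 -> fires v.
Proof.
move=> t1 pv p1 fp; apply: (network_topples (l := [:: p]) s_complete S0_ge) => //.
- by move=> q; rewrite inE => /eqP->.
- by move=> q; rewrite inE => /eqP->.
- by have := S0_ge (at_node v); rewrite network_config_node t1 /=; lia.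
Qed.

Lemma fires_of_two_links v p q : (threshold (layout n rs) v <= 2)%N ->
  p \in links (layout n rs) v -> p.1.1 -> fires p.2 ->
  q \in links (layout n rs) v -> q.1.1 -> fires q.2 -> p.1.2 != q.1.2 -> fires v.
Proof.
move=> t2 pv p1 fp qv q1 fq pq.
apply: (network_topples (l := [:: p; q]) s_complete S0_ge) => /=.
- by rewrite inE pq.
- by move=> r; rewrite !inE => /orP[/eqP->|/eqP->].
- by move=> r; rewrite !inE => /orP[/eqP->|/eqP->].
- by have := S0_ge (at_node v); rewrite network_config_node; lia.
Qed.

Let thr X Y Z := threshold (layout n rs) (X, Y, Z).

Lemma fires_right X Y Z : link_x (layout n rs) (X, Y, Z) ->
  thr (X + 1) Y Z = 1%N -> fires (X, Y, Z) -> fires (X + 1, Y, Z).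
Proof.
move=> l t f.
apply: (fires_of_link (p := (link_x (layout n rs) (X, Y, Z),
  ((X + 1) * 2 - 1, Y * 2, Z * 2), (X, Y, Z)))) => //.
by rewrite /links !inE addrK eqxx orbT.
Qed.

Lemma fires_left X Y Z : link_x (layout n rs) (X, Y, Z) ->
  thr X Y Z = 1%N -> fires (X + 1, Y, Z) -> fires (X, Y, Z).
Proof.
move=> l t f.
apply: (fires_of_link (p := (link_x (layout n rs) (X, Y, Z),
  (X * 2 + 1, Y * 2, Z * 2), (X + 1, Y, Z)))) => //.
by rewrite /links !inE eqxx.
Qed.

Lemma fires_up X Y Z : link_y (layout n rs) (X, Y, Z) ->
  thr X (Y + 1) Z = 1%N -> fires (X, Y, Z) -> fires (X, Y + 1, Z).
Proof.
move=> l t f.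
apply: (fires_of_link (p := (link_y (layout n rs) (X, Y, Z),
  (X * 2, (Y + 1) * 2 - 1, Z * 2), (X, Y, Z)))) => //.
by rewrite /links !inE addrK eqxx !orbT.
Qed.

Lemma fires_down X Y Z : link_y (layout n rs) (X, Y, Z) ->
  thr X Y Z = 1%N -> fires (X, Y + 1, Z) -> fires (X, Y, Z).
Proof.
move=> l t f.
apply: (fires_of_link (p := (link_y (layout n rs) (X, Y, Z),
  (X * 2, Y * 2 + 1, Z * 2), (X, Y + 1, Z)))) => //.
by rewrite /links !inE eqxx !orbT.
Qed.

Lemma fires_above X Y Z : link_z (layout n rs) (X, Y, Z) ->
  thr X Y (Z + 1) = 1%N -> fires (X, Y, Z) -> fires (X, Y, Z + 1).
Proof.
move=> l t f.
apply: (fires_of_link (p := (link_z (layout n rs) (X, Y, Z),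
  (X * 2, Y * 2, (Z + 1) * 2 - 1), (X, Y, Z)))) => //.
by rewrite /links !inE addrK eqxx !orbT.
Qed.

Lemma fires_below X Y Z : link_z (layout n rs) (X, Y, Z) ->
  thr X Y Z = 1%N -> fires (X, Y, Z + 1) -> fires (X, Y, Z).
Proof.
move=> l t f.
apply: (fires_of_link (p := (link_z (layout n rs) (X, Y, Z),
  (X * 2, Y * 2, Z * 2 + 1), (X, Y, Z + 1)))) => //.
by rewrite /links !inE eqxx !orbT.
Qed.

(** Row 0 is linked across all levels, so a trunk spans a whole vertical line and a fact obtained at
    one height is available to every rule. *)
Lemma fires_trunk t x y Z Z' : (t < n)%N ->
  fires (pos n.+2 x t, pos 4 y 0, Z) -> fires (pos n.+2 x t, pos 4 y 0, Z').
Proof.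
move=> tn; have tn2 : (t < n.+2)%N by lia.
have l W : link_z (layout n rs) (pos n.+2 x t, pos 4 y 0, W).
  by rewrite /= !residue_pos.
have th W : thr (pos n.+2 x t) (pos 4 y 0) W = 1%N.
  by rewrite /thr /= !residue_pos // /local_threshold /= !andbF.
have up k W : fires (pos n.+2 x t, pos 4 y 0, W) ->
   fires (pos n.+2 x t, pos 4 y 0, W + k%:Z).
  move=> f; elim: k => [|k IHk]; first by rewrite addr0.
  by rewrite -[k.+1]addn1 PoszD addrA; apply: fires_above.
have down k W : fires (pos n.+2 x t, pos 4 y 0, W + k%:Z) ->
   fires (pos n.+2 x t, pos 4 y 0, W).
  elim: k => [|k IHk]; first by rewrite addr0.
  by rewrite -[k.+1]addn1 PoszD addrA => f; apply/IHk/fires_below.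
case: (lerP Z Z') => ZZ f.
  have -> : Z' = Z + (absz (Z' - Z)) by lia.
  exact: up.
by apply: (down (absz (Z - Z'))); rewrite (_ : Z' + _ = Z) //; lia.
Qed.

Section Rule.

Variables (i : nat) (x y : int).
Hypothesis i_lt : (i < size rs)%N.

Let r := nth rule0 rs i.
Let hgt := height rs.
Let node x' a y' b k : vertex := (pos n.+2 x' a, pos 4 y' b, pos hgt 0 (3 * i + k)).

Lemma level_node k : (k < 3)%N ->
  rule_at rs (pos hgt 0 (3 * i + k)) = r /\
  level_at rs (pos hgt 0 (3 * i + k)) = k.
Proof.
move=> k3; rewrite /rule_at /level_at residue_pos; last by rewrite /height; lia.
by split; [rewrite /r; congr nth; lia | lia].
Qed.

Lemma wf_node : well_formed n r.
Proof. exact/wf/mem_nth. Qed.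

Let fires_at x' a y' b k := fires (node x' a y' b k).

Lemma thr_row X y' b k : (k < 3)%N -> (b < 4)%N -> k <> 1%N \/ b = 0%N \/ b = 3 ->
  thr X (pos 4 y' b) (pos hgt 0 (3 * i + k)) = 1%N.
Proof.
move=> k3 b4 kb; rewrite /thr /= (proj2 (level_node k3)) residue_pos //.
rewrite /local_threshold; case: ifP => // /andP[/eqnP k1].
case: kb => [//|[|] ->] /=; rewrite !andbF //.
Qed.

Lemma thr_column x' a Y k : (k < 3)%N -> (a < n)%N ->
  thr (pos n.+2 x' a) Y (pos hgt 0 (3 * i + k)) = 1%N.
Proof.
move=> k3 an; rewrite /thr /= residue_pos; last by lia.
have aF : (a == n) = false by lia.
have aF' : (a == n.+1) = false by lia.
by rewrite /local_threshold aF aF' andbF.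
Qed.

Lemma row_right x' a1 a2 y' b k : (k < 3)%N -> (b < 4)%N -> k <> 1%N \/ b = 3 ->
  (a1 <= a2)%N -> (a2 <= n.+2)%N ->
  (forall a, (a1 <= a)%N -> (a < a2)%N -> local_link_x n r k a b) ->
  fires_at x' a1 y' b k -> fires_at x' a2 y' b k.
Proof.
move=> k3 b4 kb a12 a2n l f.
elim: a2 a12 a2n l => [|a2 IHa] a12 a2n l.
  by move: a12; rewrite leqn0 => /eqP <-.
move: a12; rewrite leq_eqVlt => /orP[/eqP <- //|a12].
rewrite /fires_at /node -pos_next; apply: fires_right.
- have [rE kE] := level_node k3.
  by rewrite /= rE kE !residue_pos //; apply: l.
- by apply: thr_row => //; case: kb; auto.
- apply: IHa => //; first by apply: ltnW.
  by move=> a h1 h2; apply: l => //; apply: ltnW.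
Qed.

Lemma row_left x' a1 a2 y' b k : (k < 3)%N -> (b < 4)%N -> k <> 1%N \/ b = 3 ->
  (a1 <= a2)%N -> (a2 <= n.+2)%N ->
  (forall a, (a1 <= a)%N -> (a < a2)%N -> local_link_x n r k a b) ->
  fires_at x' a2 y' b k -> fires_at x' a1 y' b k.
Proof.
move=> k3 b4 kb a12 a2n l.
elim: a2 a12 a2n l => [|a2 IHa] a12 a2n l.
  by move: a12; rewrite leqn0 => /eqP <-.
move: a12; rewrite leq_eqVlt => /orP[/eqP <- //|a12] f.
apply: IHa => //; first by apply: ltnW.
  by move=> a h1 h2; apply: l => //; apply: ltnW.
apply: fires_left; last by rewrite pos_next.
- have [rE kE] := level_node k3.
  by rewrite /= rE kE !residue_pos //; apply: l.
- by apply: thr_row => //; case: kb; auto.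
Qed.

Lemma column_up x' a y' b1 b2 k : (k < 3)%N -> (a < n)%N ->
  (b1 <= b2)%N -> (b2 <= 4)%N ->
  (forall b, (b1 <= b)%N -> (b < b2)%N -> local_link_y n r k a b) ->
  fires_at x' a y' b1 k -> fires_at x' a y' b2 k.
Proof.
move=> k3 an b12 b24 l f.
elim: b2 b12 b24 l => [|b2 IHb] b12 b24 l.
  by move: b12; rewrite leqn0 => /eqP <-.
move: b12; rewrite leq_eqVlt => /orP[/eqP <- //|b12].
rewrite /fires_at /node -pos_next; apply: fires_up.
- have [rE kE] := level_node k3.
  by rewrite /= rE kE !residue_pos //; [apply: l | lia].
- exact: thr_column.
- apply: IHb => //; first by apply: ltnW.
  by move=> b h1 h2; apply: l => //; apply: ltnW.
Qed.

Lemma column_down x' a y' b1 b2 k : (k < 3)%N -> (a < n)%N ->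
  (b1 <= b2)%N -> (b2 <= 4)%N ->
  (forall b, (b1 <= b)%N -> (b < b2)%N -> local_link_y n r k a b) ->
  fires_at x' a y' b2 k -> fires_at x' a y' b1 k.
Proof.
move=> k3 an b12 b24 l.
elim: b2 b12 b24 l => [|b2 IHb] b12 b24 l.
  by move: b12; rewrite leqn0 => /eqP <-.
move: b12; rewrite leq_eqVlt => /orP[/eqP <- //|b12] f.
apply: IHb => //; first by apply: ltnW.
  by move=> b h1 h2; apply: l => //; apply: ltnW.
apply: fires_down; last by rewrite pos_next.
- have [rE kE] := level_node k3.
  by rewrite /= rE kE !residue_pos //; [apply: l | lia].
- exact: thr_column.
Qed.

Lemma fires_wrap_x x' y' b k : fires_at x' n.+2 y' b k = fires_at (x' + 1) 0 y' b k.
Proof. by rewrite /fires_at /node pos_wrap. Qed.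

Lemma fires_wrap_y x' a y' k : fires_at x' a y' 4 k = fires_at x' a (y' + 1) 0 k.
Proof. by rewrite /fires_at /node (pos_wrap 4). Qed.

Lemma fires_input k : (k < 3)%N -> k <> 1%N ->
  fires_at (shift (sx r) x) (src k r) (shift (sy r) y) 0 k -> fires_at x n y 1 k.
Proof.
move=> k3 k1 f; have srcn := src_lt wf_node k.
have kF : eqn k 1 = false by apply/eqnP.
have {}f : fires_at (shift (sx r) x) (src k r) y 1 k.
  case syE: (sy r) f => f; last first.
    rewrite shift0 in f; apply: column_up f => // -[|b] // _ _.
    by rewrite /local_link_y kF eqxx syE.
  rewrite shift1 -fires_wrap_y in f; apply: column_down f => // b b1 _.
  by rewrite /local_link_y kF eqxx syE; case: b b1.
case sxE: (sx r) f => f; last first.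
  rewrite shift0 in f; apply: row_right f; auto; try lia.
  by move=> a h1 h2; rewrite /local_link_x kF sxE h1 h2.
rewrite shift1 in f; apply: (row_left (a2 := n.+2)); auto; try lia.
  by move=> a h1 h2; rewrite /local_link_x kF sxE h1 orbT.
rewrite fires_wrap_x; apply: row_left f; auto; try lia.
by move=> a h1 h2; rewrite /local_link_x kF sxE h2.
Qed.

Lemma fires_output : fires_at x n.+1 y 3 1 ->
  fires_at (shift (dx r) x) (dst r) (shift (dy r) y) 0 1.
Proof.
move=> f; have dstn := dst_lt wf_node.
have dstF : (n <= dst r)%N = false by lia.
have {}f : fires_at (shift (dx r) x) (dst r) y 3 1.
  case dxE: (dx r); last first.
    rewrite shift0; apply: row_left f; auto; try lia.
    by move=> a h1 h2; rewrite /local_link_x /= dxE h1 -ltnS h2.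
  rewrite shift1; have {}f : fires_at (x + 1) 0 y 3 1.
    rewrite -fires_wrap_x; apply: row_right f; auto; try lia.
    move=> a h1 h2; rewrite /local_link_x /= dxE.
    by rewrite (_ : a == n.+1) ?orbT //; lia.
  apply: row_right f; auto; try lia.
  by move=> a h1 h2; rewrite /local_link_x /= dxE h2.
case dyE: (dy r); last first.
  rewrite shift0; apply: column_down f => // b _ b3.
  by rewrite /local_link_y /= dstF eqxx dyE; move: b3; case: b => [|[|[|]]].
rewrite shift1 -fires_wrap_y; apply: column_up f => // b b3 b4.
by rewrite /local_link_y /= dstF eqxx dyE; move: b3 b4; case: b => [|[|[|[]]]].
Qed.

(** The two source levels feed the first gate, and its two outgoing wires are exactly the two inputs
    of the second. *)
Lemma fires_gate : fires_at x n y 1 0 -> fires_at x n y 1 2 ->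
  fires_at x n.+1 y 3 1.
Proof.
have [r0 k0] := level_node (isT : (0 < 3)%N).
have [r1 k1] := level_node (isT : (1 < 3)%N).
have [r2 k2] := level_node (isT : (2 < 3)%N).
have nn : (n == n.+1) = false by lia.
have nn' : (n.+1 == n) = false by lia.
have z1 : pos hgt 0 (3 * i + 1) = pos hgt 0 (3 * i + 0) + 1 by rewrite /pos; lia.
have z2 : pos hgt 0 (3 * i + 2) = pos hgt 0 (3 * i + 1) + 1 by rewrite /pos; lia.
move=> f0 f2.
have g : fires_at x n y 1 1.
  set X := pos n.+2 x n; set Y := pos 4 y 1; set Z := pos hgt 0 (3 * i + 1).
  apply: (fires_of_two_links
    (p := (true, (X * 2, Y * 2, Z * 2 - 1), (X, Y, Z - 1)))
    (q := (true, (X * 2, Y * 2, Z * 2 + 1), (X, Y, Z + 1)))) => //.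
  - by rewrite /= /local_threshold; case: ifP.
  - rewrite /links !inE; apply/orP; right.
    rewrite /= !residue_pos // (_ : level_at rs (Z - 1) = 0%N); last first.
      by rewrite /Z z1 addrK.
    by rewrite /local_link_z /= !eqxx !orbT.
  - by rewrite /= /Z z1 addrK.
  - rewrite /links !inE /= !residue_pos // k1.
    by rewrite /local_link_z /= !eqxx !orbT.
  - by rewrite /= /Z -z2.
  - by rewrite /= xpair_eqE; lia.
have g1 : fires_at x n.+1 y 1 1.
  rewrite /fires_at /node -pos_next; apply: fires_right => //.
    by rewrite /= r1 k1 !residue_pos // /local_link_x /= eqxx.
  by rewrite /thr /= k1 pos_next !residue_pos // /local_threshold /= nn' andbF.
have g2 : fires_at x n y 2 1.
  rewrite /fires_at /node -(pos_next 4); apply: fires_up => //.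
    by rewrite /= r1 k1 !residue_pos // /local_link_y /= leqnn.
  by rewrite /thr /= k1 pos_next !residue_pos // /local_threshold /= nn andbF.
have v : fires_at x n.+1 y 2 1.
  set X := pos n.+2 x n.+1; set Y := pos 4 y 2; set Z := pos hgt 0 (3 * i + 1).
  apply: (fires_of_two_links
    (p := (true, (X * 2 - 1, Y * 2, Z * 2), (X - 1, Y, Z)))
    (q := (true, (X * 2, Y * 2 - 1, Z * 2), (X, Y - 1, Z)))) => //.
  - by rewrite /= /local_threshold; case: ifP.
  - rewrite /links !inE /= /X pos_pred !residue_pos // r1 k1.
    by rewrite /local_link_x /= !eqxx !orbT.
  - by rewrite /= /X pos_pred.
  - rewrite /links !inE /= /Y pos_pred !residue_pos // r1 k1.
    by rewrite /local_link_y /= leqnSn !eqxx !orbT.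
  - by rewrite /= /Y pos_pred.
  - by rewrite /= !xpair_eqE; lia.
rewrite /fires_at /node -(pos_next 4); apply: fires_up => //.
  by rewrite /= r1 k1 !residue_pos // /local_link_y /= leqnSn eqxx.
by rewrite /thr /= k1 pos_next !residue_pos // /local_threshold /= !andbF.
Qed.

End Rule.

Lemma derives_fires (seed : nat -> int -> int -> Prop) t x y Z :
  (forall t x y, seed t x y -> (t < n)%N /\
     exists Z, 6 <= S0 (at_node (pos n.+2 x t, pos 4 y 0, Z))) ->
  derives rs seed t x y -> (t < n)%N /\ fires (pos n.+2 x t, pos 4 y 0, Z).
Proof.
move=> hseed D; elim: D Z => {t x y} [t x y st Z|r x y rin _ IH1 _ IH2 Z].
  have [tn [W SW]] := hseed t x y st; split=> //; apply: (@fires_trunk _ _ _ W) => //.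
  by apply: (complete_topples (l := [::]) s_complete) => //=; rewrite addr0.
have iE : nth rule0 rs (index r rs) = r by rewrite nth_index.
have il : (index r rs < size rs)%N by rewrite index_mem.
have dn : (dst r < n)%N by case/and3P: (wf rin).
(* The copy of the rule in vertical period 0 is used; the trunk carries its conclusion to height
   [Z]. *)
split=> //; apply: (@fires_trunk _ _ _ (pos (height rs) 0 (3 * index r rs + 1))) => //.
have := @fires_output _ x y il; rewrite iE; apply.
apply: fires_gate => //; apply: fires_input => //; rewrite iE /src /=.
- by have [_] := IH1 (pos (height rs) 0 (3 * index r rs + 0)).
- by have [_] := IH2 (pos (height rs) 0 (3 * index r rs + 2)).
Qed.

End Firing.

(** * Counter and tape machines as Horn rules *)

Section Machine.

Variables (Q R G : finType).

(** Counters receive the inputs, each given by the position of one seed; the tape serves to run an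
    arbitrary decider on the printed word. *)
Inductive instr :=
  | IInc of R & Q
  | IDec of R & Q & Q
  | ITape of (G -> Q * G * direction).

Record config := Config {
  st : Q;
  rg : R -> nat;
  tp : int -> G;
  hd : int
}.

Definition upd (T : eqType) (U : Type) (f : T -> U) (x : T) (u : U) : T -> U :=
  fun y => if y == x then u else f y.

Definition displacement (d : direction) : int := if d is MoveLeft then -1 else 1.

Variable prog : Q -> instr.

Definition mstep (c : config) : config :=
  let: Config q g t h := c in
  match prog q with
  | IInc r q' => Config q' (upd g r (g r).+1) t h
  | IDec r q' q0 =>
      if g r is k.+1 then Config q' (upd g r k) t h else Config q0 g t h
  | ITape f =>
      let: (q', b, d) := f (t h) in Config q' g (upd t h b) (h + displacement d)
  end.

Definition touches (i : instr) (r : R) : bool :=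
  match i with IInc r' _ | IDec r' _ _ => r == r' | ITape _ => false end.

Definition is_tape (i : instr) : bool := if i is ITape _ then true else false.

(* The fact [(net, x, t)] speaks about position [x] at time [t]. *)
Inductive net :=
  | NHalt | NStart | NInputA | NInputB
  | NZero | NPositive
  | NHead | NLeftOfHead | NRightOfHead | NBlank
  | NState of Q
  | NReg of R | NRegZero of R | NRegPos of R | NIsZero of R | NIsPos of R
  | NSym of G | NRead of G | NScanned of G | NKeep of G.

Definition net_code (t : net) : nat * option Q * option R * option G :=
  match t with
  | NHalt => (0, None, None, None) | NStart => (1, None, None, None)
  | NInputA => (2, None, None, None) | NInputB => (3, None, None, None)
  | NZero => (4, None, None, None) | NPositive => (5, None, None, None)
  | NHead => (6, None, None, None) | NLeftOfHead => (7, None, None, None)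
  | NRightOfHead => (8, None, None, None) | NBlank => (9, None, None, None)
  | NState q => (10, Some q, None, None)
  | NReg r => (11, None, Some r, None) | NRegZero r => (12, None, Some r, None)
  | NRegPos r => (13, None, Some r, None) | NIsZero r => (14, None, Some r, None)
  | NIsPos r => (15, None, Some r, None)
  | NSym a => (16, None, None, Some a) | NRead a => (17, None, None, Some a)
  | NScanned a => (18, None, None, Some a) | NKeep a => (19, None, None, Some a)
  end%N.

Lemma net_code_inj : injective net_code.
Proof. by case=> [||||||||||?|?|?|?|?|?|?|?|?|?]; case=> // ? [] ->. Qed.

HB.instance Definition _ := Equality.copy net (inj_type net_code_inj).

(** The order of the first four matters: trunk 0, that of [NHalt], passes through the origin, and
    the seeds are placed on trunks 1, 2 and 3. *)
Definition nets : seq net :=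
  [:: NHalt; NStart; NInputA; NInputB; NZero; NPositive; NHead; NLeftOfHead;
      NRightOfHead; NBlank]
  ++ map NState (enum Q)
  ++ map NReg (enum R) ++ map NRegZero (enum R) ++ map NRegPos (enum R)
  ++ map NIsZero (enum R) ++ map NIsPos (enum R)
  ++ map NSym (enum G) ++ map NRead (enum G) ++ map NScanned (enum G)
  ++ map NKeep (enum G).

Arguments nets : simpl never.

Lemma mem_nets t : t \in nets.
Proof.
rewrite /nets !mem_cat.
by case: t => [||||||||||q|r|r|r|r|r|a|a|a|a]; rewrite ?map_f ?mem_enum ?orbT.
Qed.

Variables (blank : G) (start halt : Q).

(* [None] marks a register that starts at zero. *)
Variable input : R -> option bool.

Definition input_net (r : R) : net :=
  match input r with
  | None => NStart | Some false => NInputA | Some true => NInputB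
  end.

(** Facts independent of the position; they are spread in both directions over the row of their
    time. *)
Definition global (t : net) : bool :=
  match t with
  | NBlank | NState _ | NIsZero _ | NIsPos _ | NScanned _ => true
  | _ => false
  end.

(* [implies1 i j dx dy]: the fact [i] at [(x, t)] yields the fact [j] at
   [(x + dx, t + dy)]. *)
Inductive implies1 : net -> net -> int -> int -> Prop :=
  | StartZero : implies1 NStart NZero 0 0
  | StartState : implies1 NStart (NState start) 0 0
  | StartHead : implies1 NStart NHead 0 0
  | StartBlank : implies1 NStart NBlank 0 0
  | InputReg r : implies1 (input_net r) (NReg r) 0 0
  | ZeroNext : implies1 NZero NZero 0 1
  | ZeroPositive : implies1 NZero NPositive 1 0
  | PositivePositive : implies1 NPositive NPositive 1 0
  | GlobalRight t : global t -> implies1 t t 1 0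
  | GlobalLeft t : global t -> implies1 t t (- 1) 0
  | BlankSym : implies1 NBlank (NSym blank) 0 0
  | HeadLeft : implies1 NHead NLeftOfHead (- 1) 0
  | LeftLeft : implies1 NLeftOfHead NLeftOfHead (- 1) 0
  | HeadRight : implies1 NHead NRightOfHead 1 0
  | RightRight : implies1 NRightOfHead NRightOfHead 1 0
  | RegZeroIsZero r : implies1 (NRegZero r) (NIsZero r) 0 0
  | RegPosIsPos r : implies1 (NRegPos r) (NIsPos r) 0 0
  | ReadScanned a : implies1 (NRead a) (NScanned a) 0 0
  | IncState q r q' : prog q = IInc r q' -> implies1 (NState q) (NState q') 0 1
  | HaltState : implies1 (NState halt) NHalt 0 0
  | HaltPrevious : implies1 NHalt NHalt 0 (- 1).

(** Horn rules have no negation, so every test has a net for each outcome: zero or positive for a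
    counter, [NRead] or [NKeep] for a tape cell. *)
Inductive implies2 : net -> net -> net -> int -> int -> Prop :=
  | RegZero r : implies2 (NReg r) NZero (NRegZero r) 0 0
  | RegPositive r : implies2 (NReg r) NPositive (NRegPos r) 0 0
  | HeadRead a : implies2 NHead (NSym a) (NRead a) 0 0
  | LeftKeep a : implies2 NLeftOfHead (NSym a) (NKeep a) 0 0
  | RightKeep a : implies2 NRightOfHead (NSym a) (NKeep a) 0 0
  | KeepReg q r : ~~ touches (prog q) r -> implies2 (NState q) (NReg r) (NReg r) 0 1
  | KeepHead q : ~~ is_tape (prog q) -> implies2 (NState q) NHead NHead 0 1
  | KeepSym q a : ~~ is_tape (prog q) -> implies2 (NState q) (NSym a) (NSym a) 0 1
  | IncReg q r q' : prog q = IInc r q' -> implies2 (NState q) (NReg r) (NReg r) 1 1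
  | DecPos q r q' q0 : prog q = IDec r q' q0 ->
      implies2 (NState q) (NIsPos r) (NState q') 0 1
  | DecZero q r q' q0 : prog q = IDec r q' q0 ->
      implies2 (NState q) (NIsZero r) (NState q0) 0 1
  | DecRegPos q r q' q0 : prog q = IDec r q' q0 ->
      implies2 (NState q) (NRegPos r) (NReg r) (- 1) 1
  | DecRegZero q r q' q0 : prog q = IDec r q' q0 ->
      implies2 (NState q) (NRegZero r) (NReg r) 0 1
  | TapeState q f a : prog q = ITape f ->
      implies2 (NState q) (NScanned a) (NState (f a).1.1) 0 1
  | TapeWrite q f a : prog q = ITape f ->
      implies2 (NState q) (NRead a) (NSym (f a).1.2) 0 1
  | TapeMove q f a : prog q = ITape f ->
      implies2 (NState q) (NRead a) NHead (displacement (f a).2) 1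
  | TapeKeep q f a : prog q = ITape f ->
      implies2 (NState q) (NKeep a) (NSym a) 0 1.

(** * The facts that describe a run *)

Variables (inA inB : nat).

Definition initial_config : config :=
  Config start
    (fun r => match input r with
              | None => 0%N | Some false => inA | Some true => inB end)
    (fun _ => blank) 0.

Definition run (t : nat) : config := iter t mstep initial_config.

Definition holds_at (t : nat) (i : net) (x : int) : Prop :=
  let c := run t in
  match i with
  | NHalt => False
  | NStart => x = 0 /\ t = 0%N
  | NInputA => x = inA /\ t = 0%N
  | NInputB => x = inB /\ t = 0%N
  | NZero => x = 0
  | NPositive => 0 < x
  | NHead => x = hd c
  | NLeftOfHead => x < hd c
  | NRightOfHead => hd c < x
  | NBlank => t = 0%N
  | NState q => st c = q
  | NReg r => x = rg c r
  | NRegZero r => x = 0 /\ rg c r = 0%N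
  | NRegPos r => x = rg c r /\ (0 < rg c r)%N
  | NIsZero r => rg c r = 0%N
  | NIsPos r => (0 < rg c r)%N
  | NSym a => tp c x = a
  | NRead a => x = hd c /\ tp c x = a
  | NScanned a => tp c (hd c) = a
  | NKeep a => x <> hd c /\ tp c x = a
  end.

(** [NHalt] is the one fact that moves back in time, so it holds at every time up to a halting one,
    negative times included; the other facts hold at natural times only. *)
Definition holds (i : net) (x y : int) : Prop :=
  if i is NHalt then exists2 t : nat, y <= t%:Z & st (run t) = halt
  else exists2 t : nat, y = t%:Z & holds_at t i x.

Lemma implies1_sound i j dx dy x y :
  implies1 i j dx dy -> holds i x y -> holds j (x + dx) (y + dy).
Proof.
case=> {i j dx dy} /=.
1-4: by case=> t -> [x0 ->]; exists 0%N; rewrite ?addr0 ?x0 //.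
1: { move=> r; rewrite /input_net.
  case E: (input r) => [[]|]; by case=> t -> [-> ->]; exists 0%N; rewrite ?addr0 //= E. }
all: try by case=> t -> h; exists t; rewrite /= ?addr0 //; move: h => /=; lia.
- by case=> t -> ->; exists t.+1; rewrite ?addr0 //; lia.
- by case=> //= [|q|r|r|a] _ [t -> h]; exists t; rewrite ?addr0.
- by case=> //= [|q|r|r|a] _ [t -> h]; exists t; rewrite ?addr0.
- by case=> t -> ->; exists 0%N; rewrite ?addr0.
- by move=> r [t -> [_ h]]; exists t; rewrite ?addr0.
- by move=> r [t -> [_ h]]; exists t; rewrite ?addr0.
- by move=> a [t -> [-> h]]; exists t; rewrite ?addr0.
- move=> q r q' pq [t -> h]; exists t.+1; first by lia.
  by rewrite /run iterS -/(run t) /mstep; case: (run t) h => ? ? ? ? /= ->; rewrite pq.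
- by case=> t h1 h2; exists t => //; lia.
Qed.

Lemma implies2_sound i k j dx dy x y :
  implies2 i k j dx dy -> holds i x y -> holds k x y -> holds j (x + dx) (y + dy).
Proof.
have next t P : P (mstep (run t)) -> exists2 t' : nat, t%:Z + 1 = t'%:Z & P (run t').
  by move=> Pt; exists t.+1; [lia | ].
case=> {i k j dx dy} /=.
- move=> r [t -> h] [_ _ h']; rewrite !addr0; exists t => //; lia.
- move=> r [t -> h] [_ _ h']; rewrite !addr0; exists t => //; lia.
- by move=> a [t -> h] [_ [<-] h']; rewrite !addr0; exists t.
- move=> a [t -> h] [_ [<-] h']; rewrite !addr0; exists t => //; split=> //; lia.
- move=> a [t -> h] [_ [<-] h']; rewrite !addr0; exists t => //; split=> //; lia.
- move=> q r nt [t -> h] [_ [<-] h']; rewrite addr0.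
  apply: (next t (fun c => x = rg c r)); move: nt h h'; rewrite /mstep.
  case: (run t) => q' g tape h /= nt -> ->; case: (prog q) nt => /=.
  + by move=> r' q'' /negPf E; rewrite /upd E.
  + by move=> r' q'' q0 /negPf E; case: (g r') => //= k; rewrite /upd E.
  + by move=> f _; case: (f _) => [[]].
- move=> q nt [t -> h] [_ [<-] h']; rewrite addr0.
  apply: (next t (fun c => x = hd c)); move: nt h h'; rewrite /mstep.
  case: (run t) => q' g tape h /= nt -> ->; case: (prog q) nt => //=.
  by move=> r' q'' q0 _; case: (g r').
- move=> q a nt [t -> h] [_ [<-] h']; rewrite addr0.
  apply: (next t (fun c => tp c x = a)); move: nt h h'; rewrite /mstep.
  case: (run t) => q' g tape h /= nt -> <-; case: (prog q) nt => //=.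
  by move=> r' q'' q0 _; case: (g r').
- move=> q r q' pq [t -> h] [_ [<-] h'].
  apply: (next t (fun c => x + 1 = rg c r)); move: h h'; rewrite /mstep.
  by case: (run t) => ? g tape h /= -> ->; rewrite pq /= /upd eqxx; lia.
- move=> q r q' q0 pq [t -> h] [_ [<-] h'].
  apply: (next t (fun c => st c = q')); move: h h'; rewrite /mstep.
  by case: (run t) => ? g tape h /= -> ; rewrite pq; case: (g r).
- move=> q r q' q0 pq [t -> h] [_ [<-] h'].
  apply: (next t (fun c => st c = q0)); move: h h'; rewrite /mstep.
  by case: (run t) => ? g tape h /= -> ; rewrite pq; case: (g r).
- move=> q r q' q0 pq [t -> h] [_ [<-] h'].
  apply: (next t (fun c => x - 1 = rg c r)); move: h h'; rewrite /mstep.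
  case: (run t) => ? g tape h /= -> [-> ]; rewrite pq; case: (g r) => // k _.
  by rewrite /= /upd eqxx; lia.
- move=> q r q' q0 pq [t -> h] [_ [<-] h']; rewrite addr0.
  apply: (next t (fun c => x = rg c r)); move: h h'; rewrite /mstep.
  by case: (run t) => ? g tape h /= -> [-> g0]; rewrite pq g0 /= g0.
- move=> q f a pq [t -> h] [_ [<-] h'].
  apply: (next t (fun c => st c = (f a).1.1)); move: h h'; rewrite /mstep.
  by case: (run t) => ? g tape h /= -> <-; rewrite pq; case: (f _) => [[]].
- move=> q f a pq [t -> h] [_ [<-] h']; rewrite addr0.
  apply: (next t (fun c => tp c x = (f a).1.2)); move: h h'; rewrite /mstep.
  case: (run t) => ? g tape h /= -> [-> <-]; rewrite pq; case: (f _) => [[? ?] ?] /=.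
  by rewrite /upd eqxx.
- move=> q f a pq [t -> h] [_ [<-] h'].
  apply: (next t (fun c => x + displacement (f a).2 = hd c)); move: h h'; rewrite /mstep.
  by case: (run t) => ? g tape h /= -> [-> <-]; rewrite pq; case: (f _) => [[? ?] ?].
- move=> q f a pq [t -> h] [_ [<-] h']; rewrite addr0.
  apply: (next t (fun c => tp c x = a)); move: h h'; rewrite /mstep.
  case: (run t) => ? g tape h /= -> [xh <-]; rewrite pq; case: (f _) => [[? ?] ?] /=.
  by rewrite /upd; case: eqP.
Qed.

(** * Derivability of every configuration of the run *)

Section Complete.

Variable D : net -> int -> int -> Prop.

Hypothesis D1 : forall i j dx dy x y,
  implies1 i j dx dy -> D i x y -> D j (x + dx) (y + dy).
Hypothesis D2 : forall i k j dx dy x y,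
  implies2 i k j dx dy -> D i x y -> D k x y -> D j (x + dx) (y + dy).
Hypothesis D_start : D NStart 0 0.
Hypothesis D_inA : D NInputA inA%:Z 0.
Hypothesis D_inB : D NInputB inB%:Z 0.

Lemma D1_here i j x y : implies1 i j 0 0 -> D i x y -> D j x y.
Proof. by move=> r d; have := D1 r d; rewrite !addr0. Qed.

Lemma D2_here i k j x y : implies2 i k j 0 0 -> D i x y -> D k x y -> D j x y.
Proof. by move=> r d d'; have := D2 r d d'; rewrite !addr0. Qed.

Lemma D1_next i j x (t : nat) : implies1 i j 0 1 -> D i x t -> D j x t.+1.
Proof. by move=> r d; have := D1 r d; rewrite addr0 -[t.+1]addn1 PoszD. Qed.

Lemma D2_next i k j x (t : nat) : implies2 i k j 0 1 -> D i x t -> D k x t -> D j x t.+1.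
Proof. by move=> r d d'; have := D2 r d d'; rewrite addr0 -[t.+1]addn1 PoszD. Qed.

Lemma D_right i x y (k : nat) : implies1 i i 1 0 -> D i x y -> D i (x + k%:Z) y.
Proof.
move=> r d; elim: k => [|k IHk]; first by rewrite addr0.
by have := D1 r IHk; rewrite addr0 -[k.+1]addn1 PoszD addrA.
Qed.

Lemma D_left i x y (k : nat) : implies1 i i (- 1) 0 -> D i x y -> D i (x - k%:Z) y.
Proof.
move=> r d; elim: k => [|k IHk]; first by rewrite subr0.
by have := D1 r IHk; rewrite addr0 -[k.+1]addn1 PoszD opprD addrA.
Qed.

Lemma D_global i x x' y : global i -> D i x y -> D i x' y.
Proof.
move=> gi d; case: (lerP x x') => xx.
  have -> : x' = x + (absz (x' - x))%:Z by lia.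
  by apply: D_right d; constructor.
have -> : x' = x - (absz (x' - x))%:Z by lia.
by apply: D_left d; constructor.
Qed.

Lemma D_positive x y : D NZero 0 y -> 0 < x -> D NPositive x y.
Proof.
move=> /(D1 ZeroPositive) d x0.
have -> : x = (0 + 1) + (absz (x - 1)%R)%:Z by lia.
by apply: D_right; [constructor | rewrite addr0 in d].
Qed.

Lemma D_left_of_head h x y : D NHead h y -> x < h -> D NLeftOfHead x y.
Proof.
move=> /(D1 HeadLeft) d xh; have -> : x = (h - 1) - (absz (h - 1 - x)%R)%:Z by lia.
by apply: D_left; [constructor | rewrite addr0 in d].
Qed.

Lemma D_right_of_head h x y : D NHead h y -> h < x -> D NRightOfHead x y.
Proof.
move=> /(D1 HeadRight) d xh; have -> : x = (h + 1) + (absz (x - h - 1)%R)%:Z by lia.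
by apply: D_right; [constructor | rewrite addr0 in d].
Qed.

(** The facts that pass from one time to the next. Outcomes of tests, and the side of the head on
    which a cell lies, are derived afresh in each row. *)
Definition derived_at (t : nat) : Prop :=
  let c := run t in
  [/\ D NZero 0 t, forall x, D (NState (st c)) x t,
      forall r, D (NReg r) (rg c r)%:Z t, D NHead (hd c) t
    & forall x, D (NSym (tp c x)) x t].

Lemma derived_at0 : derived_at 0.
Proof.
have dB : forall x, D NBlank x 0.
  by move=> x; apply: (@D_global _ 0) => //; apply: D1_here D_start; constructor.
split=> /=.
- by apply: D1_here D_start; constructor.
- by move=> x; apply: (@D_global _ 0) => //; apply: D1_here D_start; constructor.
- move=> r; apply: (D1_here (InputReg r)).
  by rewrite /input_net; case: (input r) => [[]|].
- by apply: D1_here D_start; constructor.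
- by move=> x; apply: D1_here (dB x); constructor.
Qed.

Lemma derived_atS t : derived_at t -> derived_at t.+1.
Proof.
rewrite /derived_at (_ : run t.+1 = mstep (run t)) //.
case: (run t) => q g tape h /= [dZ dQ dR dH dT].
have dZero r : g r = 0%N -> D (NRegZero r) 0 t.
  by move=> g0; apply: D2_here (RegZero r) _ dZ; have := dR r; rewrite g0.
have dPos r k : g r = k.+1 -> D (NRegPos r) (g r)%:Z t.
  by move=> gk; apply: D2_here (RegPositive r) (dR r) _; apply: D_positive => //; lia.
have dScan : forall x, D (NScanned (tape h)) x t.
  move=> x; apply: (@D_global _ h) => //; apply: D1_here (ReadScanned _) _.
  by apply: D2_here (HeadRead _) dH _.
have dRead : D (NRead (tape h)) h t by apply: D2_here (HeadRead _) dH _.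
have dKeep x : x <> h -> D (NKeep (tape x)) x t.
  move=> xh; case: (ltrP x h) => xh'.
    by apply: D2_here (LeftKeep _) (D_left_of_head dH xh') _.
  have hx : h < x by rewrite lt_neqAle xh' andbT; apply/eqP => /esym.
  by apply: D2_here (RightKeep _) (D_right_of_head dH hx) _.
have dZ' : D NZero 0 t.+1 by apply: D1_next dZ; constructor.
have nextI i j x : D i x t -> implies2 (NState q) i j 0 1 -> D j x t.+1.
  by move=> d r; apply: D2_next r (dQ _) d.
case pq: (prog q) => [r q'|r q' q0|f] /=.
- split=> //.
  + by move=> x; apply: D1_next (dQ x); apply: IncState pq.
  + move=> r'; rewrite /upd; case: eqP => [->|rr].
      have := D2 (IncReg pq) (dQ _) (dR r).
      by rewrite -!PoszD !addn1.
    apply: (nextI _ _ _ (dR r') _); constructor; rewrite pq /=.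
    exact/eqP.
  + by apply: (nextI _ _ _ dH _); constructor; rewrite pq.
  + by move=> x; apply: (nextI _ _ _ (dT x) _); constructor; rewrite pq.
- have keepR r' : r' <> r -> D (NReg r') (g r')%:Z t.+1.
    move=> rr; apply: (nextI _ _ _ (dR r') _); constructor; rewrite pq /=.
    exact/eqP.
  have keepH : D NHead h t.+1 by apply: (nextI _ _ _ dH _); constructor; rewrite pq.
  have keepT x : D (NSym (tape x)) x t.+1.
    by apply: (nextI _ _ _ (dT x) _); constructor; rewrite pq.
  case gr: (g r) => [|k]; split=> //=.
  + move=> x; apply: (nextI _ _ _ _ (DecZero pq)); apply: (@D_global _ 0) => //.
    by apply: D1_here (RegZeroIsZero r) (dZero _ gr).
  + move=> r'; case: (eqVneq r' r) => [->|/eqP rr]; last exact: keepR.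
    by rewrite gr; apply: (nextI _ _ _ _ (DecRegZero pq)); apply: dZero.
  + move=> x; apply: (nextI _ _ _ _ (DecPos pq)); apply: (@D_global _ (g r)%:Z) => //.
    by apply: D1_here (RegPosIsPos r) (dPos _ _ gr).
  + move=> r'; rewrite /upd; case: eqP => [->|rr]; last exact: keepR.
    have := D2 (DecRegPos pq) (dQ _) (dPos _ _ gr); rewrite gr.
    by rewrite -[k.+1]addn1 PoszD addrK -PoszD addn1.
- have fT x : x <> h -> D (NSym (tape x)) x t.+1.
    by move=> xh; apply: (nextI _ _ _ (dKeep _ xh) (TapeKeep _ pq)).
  have fQ x := nextI _ _ _ (dScan x) (TapeState (tape h) pq).
  have fW := nextI _ _ _ dRead (TapeWrite (tape h) pq).
  have fH := D2 (TapeMove (tape h) pq) (dQ _) dRead.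
  case: (f (tape h)) fQ fW fH => [[q' b] d] /= fQ fW fH; split=> //=.
  + move=> r; apply: (nextI _ _ _ (dR r) _); constructor; by rewrite pq.
  + by rewrite -PoszD addn1 in fH.
  + by move=> x; rewrite /upd; case: eqP => [->|]; last exact: fT.
Qed.

Lemma halt_derived t : st (run t) = halt -> D NHalt 0 0.
Proof.
have: derived_at t by elim: t => [|t]; [exact: derived_at0 | exact: derived_atS].
(* The state is known at every position, in particular at 0, from where [NHalt] descends to time
   0. *)
case=> _ dQ _ _ _ sh; have := dQ 0; rewrite sh => /(D1_here HaltState).
elim: (t) => [//|k IHk] d; apply: IHk.
by have := D1 HaltPrevious d; rewrite addr0 -[k.+1]addn1 PoszD addrK.
Qed.

End Complete.

End Machine.

(** * The sandpile of a machine *)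

(** The rules of a machine are given by a relation. Only finitely many rules have all nets below
    [n], and their list is filtered classically. *)
Lemma finite_rules (n : nat) (P : rule -> Prop) :
  (forall r, P r -> well_formed n r) ->
  exists rs : seq rule, forall r, r \in rs <-> P r.
Proof.
move=> wf.
pose T : finType := ('I_n * 'I_n * 'I_n * (bool * bool * bool * bool))%type.
pose mk (t : T) : rule :=
  let: (i, k, j, (a, b, c, d)) := t in Rule i k j a b c d.
exists [seq r <- [seq mk t | t <- enum T] | `[< P r >]] => r.
rewrite mem_filter; split=> [/andP[/asboolP //]|Pr].
apply/andP; split; first exact/asboolP.
case: r Pr => s1 s2 d a b c e Pr; have /and3P[/= h1 h2 h3] := wf _ Pr.
apply/mapP; exists (Ordinal h1, Ordinal h2, Ordinal h3, (a, b, c, e)) => //.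
exact: mem_enum.
Qed.

Lemma at_node_inj : injective at_node.
Proof.
have inj2 (a b : int) : a * 2 = b * 2 -> a = b by lia.
by move=> [[a b] c] [[x y] z] [/inj2 -> /inj2 -> /inj2 ->].
Qed.

Lemma half_period (d : nat) (x x' : int) : (0 < d)%N ->
  (x = x' %[mod (2 * d)%N])%Z ->
  (x %% 2)%Z = (x' %% 2)%Z /\ residue d (x %/ 2)%Z = residue d (x' %/ 2)%Z.
Proof.
move=> d0 e.
pose q := (x %/ (2 * d)%N)%Z - (x' %/ (2 * d)%N)%Z.
have xE : x = x' + q * d%:Z * 2.
  rewrite {1}(divz_eq x (2 * d)%N) {1}(divz_eq x' (2 * d)%N) e /q PoszM mulrBl.
  rewrite mulrBl -!mulrA [d%:Z * 2]mulrC; lia.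
have h : (x %/ 2)%Z = q * d%:Z + (x' %/ 2)%Z by rewrite xE; lia.
split; first by rewrite xE addrC modzMDl.
by rewrite h /residue modzMDl.
Qed.

Section Sandpile.

Variables (Q R G : finType) (prog : Q -> instr Q R G) (blank : G) (start halt : Q).
Variable input : R -> option bool.

Let net_index (i : net Q R G) : nat := index i (nets Q R G).

Lemma net_index_lt i : (net_index i < size (nets Q R G))%N.
Proof. by rewrite index_mem mem_nets. Qed.

Lemma net_index_inj : injective net_index.
Proof.
move=> i j; rewrite /net_index => e.
by rewrite -(nth_index (NHalt Q R G) (mem_nets i)) e nth_index ?mem_nets.
Qed.

(** A rule with one premise is treated as a rule with that premise repeated, so one gadget serves
    all. *)
Definition machine_rule (i k j : net Q R G) (ex ey : int) : Prop :=
  implies2 prog i k j ex ey \/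
  i = k /\ implies1 prog blank start halt input i j ex ey.

(** Offsets in the layout are 0 or 1; a displacement by -1 moves the sources instead of the
    destination. *)
Definition layout_rule (i k j : net Q R G) (ex ey : int) : rule :=
  Rule (net_index i) (net_index k) (net_index j)
    (ex == -1) (ey == -1) (ex == 1) (ey == 1).

Lemma machine_rule_moves i k j ex ey : machine_rule i k j ex ey ->
  ex \in [:: -1; 0; 1] /\ ey \in [:: -1; 0; 1].
Proof.
by case=> [|[_]] [] => // *; case: (_.2).
Qed.

Lemma shift_move (e x : int) : e \in [:: -1; 0; 1] ->
  shift (e == 1) x = shift (e == -1) x + e.
Proof. by rewrite !inE /shift => /or3P[] /eqP-> /=; lia. Qed.

Lemma machine_rules : exists rs : seq rule, forall r, r \in rs <->
  exists i k j ex ey, machine_rule i k j ex ey /\ r = layout_rule i k j ex ey.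
Proof.
apply: (@finite_rules (size (nets Q R G))) => r [i [k [j [ex [ey [_ ->]]]]]].
by apply/and3P; split; apply: net_index_lt.
Qed.

Let n : nat := size (nets Q R G).

(** Trunk [k] of the cell at position [a] and time 0; the factor 2 comes from the subdivision. *)
Definition seed_vertex (k a : nat) : vertex := ((2 * (k + n.+2 * a))%N%:Z, 0, 0).

Lemma seed_vertexE k a : seed_vertex k a = at_node (pos n.+2 a k, pos 4 0 0, 0).
Proof.
by rewrite /seed_vertex /at_node; congr (_, _, _); rewrite /pos; lia.
Qed.

Definition seed_vertices (inA inB : nat) : seq vertex :=
  [:: seed_vertex 1 0; seed_vertex 2 inA; seed_vertex 3 inB].

Lemma nets_gt9 : (9 < n)%N.
Proof. by rewrite /n /nets size_cat. Qed.

Lemma seed_vertices_uniq inA inB : uniq (seed_vertices inA inB).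
Proof.
have n9 := nets_gt9.
have inj k k' a a' : (k < n.+2)%N -> (k' < n.+2)%N -> k != k' ->
   (seed_vertex k a == seed_vertex k' a') = false.
  move=> kn kn' kk; apply/eqP; rewrite !seed_vertexE.
  move=> /at_node_inj /(congr1 (fun v : vertex => residue n.+2 v.1.1)) /=.
  rewrite !residue_pos // => e'.
  by rewrite e' eqxx in kk.
by rewrite /= !inE !inj //; lia.
Qed.

Variable rs : seq rule.
Hypothesis rsE : forall r, r \in rs <->
  exists i k j ex ey, machine_rule i k j ex ey /\ r = layout_rule i k j ex ey.

Let P : configuration := network_config (layout n rs).

Lemma rs_gt0 : (0 < size rs)%N.
Proof.
have : layout_rule (NStart Q R G) (NStart Q R G) (NZero Q R G) 0 0 \in rs.
  apply/rsE; do 5 eexists; split; last by [].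
  by right; split=> //; constructor.
by case: (rs).
Qed.

Lemma rs_wf r : r \in rs -> well_formed n r.
Proof.
move=> /rsE[i [k [j [ex [ey [_ ->]]]]]].
by apply/and3P; split; apply: net_index_lt.
Qed.

Lemma P_periodic : periodic (2 * n.+2) (2 * 4) (2 * height rs) P.
Proof.
have h0 := height_gt0 rs_gt0.
split=> //; first by rewrite muln_gt0.
move=> x y z x' y' z' ex ey ez.
have [x2 xr] := half_period (ltn0Sn n.+1) ex.
have [y2 yr] := half_period (ltn0Sn 3) ey.
have [z2 zr] := half_period h0 ez.
rewrite /P /network_config /subdivide x2 y2 z2 /layout /= /rule_at /level_at.
by rewrite xr yr zr.
Qed.

Variables inA inB : nat.

Let F (v : vertex) : nat := v \in seed_vertices inA inB.

Definition machine_sandpile : configuration := fun v => P v + (F v)%:Z.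

Definition machine_encoding : finite_encoding :=
  FiniteEncoding (2 * n.+2) (2 * 4) (2 * height rs)
    (map P (box (2 * n.+2) (2 * 4) (2 * height rs)))
    [seq (v, 1%N) | v <- seed_vertices inA inB].

Lemma machine_encodes : encodes machine_encoding machine_sandpile.
Proof.
exists P, F; split=> //; first exact: P_periodic.
  by rewrite map_inj_uniq ?seed_vertices_uniq // => u v [].
move=> v k; split=> [/mapP[u us [-> ->]]|[<-]]; first by rewrite /F us.
rewrite /F; case vs: (v \in _) => // _.
by apply/mapP; exists v.
Qed.

Let seed_node (v : vertex) : bool := at_node v \in seed_vertices inA inB.

Lemma seed_nodeP v : seed_node v <->
  [\/ v = (pos n.+2 0 1, pos 4 0 0, 0), v = (pos n.+2 inA 2, pos 4 0 0, 0)
    | v = (pos n.+2 inB 3, pos 4 0 0, 0)].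
Proof.
rewrite /seed_node /seed_vertices !inE !seed_vertexE !(inj_eq at_node_inj).
split=> [/or3P[] /eqP->|[] ->]; rewrite ?eqxx ?orbT //.
- by constructor 1.
- by constructor 2.
- by constructor 3.
Qed.

Let holds_index (t : nat) (x y : int) : Prop :=
  exists2 i, t = net_index i & holds prog blank start halt input inA inB i x y.

Lemma rs_sound r : r \in rs -> sound holds_index r.
Proof.
move=> /rsE[i [k [j [ex [ey [rule ->]]]]]] x y [] /=.
have [mx my] := machine_rule_moves rule.
case=> i' /net_index_inj <- hi [k' /net_index_inj <- hk].
exists j => //; rewrite !shift_move //.
case: rule => [r2|[ik r1]]; first exact: implies2_sound r2 hi hk.
exact: implies1_sound r1 hi.
Qed.

Lemma machine_sandpile_sound s : legal machine_sandpile s ->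
  topples s origin -> exists t, st (run prog blank start input inA inB t) = halt.
Proof.
move=> sl so.
have : on n rs holds_index (0, 0, 0).
  apply: (layout_stays (seed := seed_node) (v := (0, 0, 0))
            rs_gt0 rs_wf rs_sound _ _ _ sl so) => //.
  - move=> u nu; rewrite /machine_sandpile /F; case us: (u \in _); last by rewrite addr0.
    move: us; rewrite !inE => /or3P[] /eqP us;
      by case: (nu _ (etrans us (seed_vertexE _ _))).
  - have n9 := nets_gt9; move=> u /seed_nodeP[] ->.
    + exists 1%N, 0, 0, 0; split; [by lia | by [] | ].
      by exists (NStart Q R G) => //; exists 0%N.
    + exists 2, inA%:Z, 0, 0; split; [by lia | by [] | ].
      by exists (NInputA Q R G) => //; exists 0%N.
    + exists 3, inB%:Z, 0, 0; split; [by lia | by [] | ].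
      by exists (NInputB Q R G) => //; exists 0%N.
have r0 d : residue d 0 = 0%N by rewrite /residue mod0z.
rewrite /on /local_on !r0 /cell !div0z.
case=> i /(@net_index_inj (NHalt Q R G)) <-.
by case=> t _ ht; exists t.
Qed.

Let seed_fact (t : nat) (x y : int) : Prop :=
  [\/ [/\ t = 1%N, x = 0 & y = 0], [/\ t = 2, x = inA & y = 0]
    | [/\ t = 3, x = inB & y = 0]].

Lemma machine_sandpile_complete s t : complete machine_sandpile s ->
  st (run prog blank start input inA inB t) = halt -> topples s origin.
Proof.
move=> sc ht.
pose D (i : net Q R G) x y := derives rs seed_fact (net_index i) x y.
have rule_step i k j ex ey x y : machine_rule i k j ex ey ->
    D i x y -> D k x y -> D j (x + ex) (y + ey).
  move=> rule di dk; have [mx my] := machine_rule_moves rule.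
  have rin : layout_rule i k j ex ey \in rs by apply/rsE; exists i, k, j, ex, ey.
  have back e z : shift (e == -1) (z - ((e == -1) : nat)%:Z) = z :> int.
    by rewrite /shift subrK.
  have fwd e z : e \in [:: -1; 0; 1] ->
      shift (e == 1) (z - ((e == -1) : nat)%:Z) = z + e.
    by move=> me; rewrite (shift_move _ me) back.
  (* The base cell is chosen so that the shifted sources land on [(x, y)]. *)
  have := @DerivesRule rs seed_fact _ (x - ((ex == -1) : nat)%:Z)
    (y - ((ey == -1) : nat)%:Z) rin.
  rewrite [sx _]/= [sy _]/= [dx _]/= [dy _]/= !back (fwd ex x mx) (fwd ey y my).
  move=> H; exact: (H di dk).
have dH : D (NHalt Q R G) 0 0.
  apply: halt_derived ht.
  - by move=> i j ex ey x y r d; apply: rule_step (d) (d); right.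
  - by move=> i k j ex ey x y r; apply: rule_step; left.
  - by apply: DerivesSeed; constructor 1.
  - by apply: DerivesSeed; constructor 2.
  - by apply: DerivesSeed; constructor 3.
have ge u : P u <= machine_sandpile u by rewrite /machine_sandpile lerDl.
have [|_] := derives_fires rs_gt0 rs_wf sc ge 0 _ dH; last by [].
have n9 := nets_gt9.
(* A trunk node has threshold 1, hence 5 chips, and the added chip makes it unstable. *)
have seed6 k a : (k < n)%N -> seed_vertex k a \in seed_vertices inA inB ->
    6 <= machine_sandpile (at_node (pos n.+2 a k, pos 4 0 0, 0)).
  move=> kn; rewrite seed_vertexE /machine_sandpile /F => ->.
  rewrite /P network_config_node /= residue_pos; last by lia.
  by rewrite /local_threshold /= !andbF.
move=> k x y [] [-> -> ->]; split; try lia; exists 0.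
- by apply: (seed6 1%N 0%N); [lia | rewrite inE eqxx].
- by apply: (seed6 2 inA); [lia | rewrite !inE eqxx orbT].
- by apply: (seed6 3 inB); [lia | rewrite !inE eqxx !orbT].
Qed.

Lemma machine_prediction :
  (exists2 N, is_odometer machine_sandpile N & enat_le (Fin 1) (N origin)) <->
  (exists t, st (run prog blank start input inA inB t) = halt).
Proof.
split=> [/prediction_topples[s [sl _ so]]|[t ht]].
  exact: machine_sandpile_sound sl so.
by apply: topples_prediction => s sc; apply: machine_sandpile_complete sc ht.
Qed.

End Sandpile.

(** The four fields of one chip added at [(x, 0, 0)]. *)
Definition seed_word (x : nat) : seq letter :=
  nseq x Tally ++ [:: Sep; Sep; Sep; Tally; Sep].

(* An input [a] is seeded [a] periods away from the origin, and [c] is half the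
   period in the [x] direction. *)
Lemma sandpile_of_machine (Q R G : finType) (prog : Q -> instr Q R G)
    (blank : G) (start halt : Q) (input : R -> option bool) :
  exists (w : seq letter) (c : nat), forall inA inB : nat,
  exists (e : finite_encoding) (S0 : configuration),
  [/\ encodes e S0,
      encoding_word e = w ++ seed_word 2 ++ seed_word (2 * (2 + c * inA))
                          ++ seed_word (2 * (3 + c * inB))
    & (exists2 N, is_odometer S0 N & enat_le (Fin 1) (N origin)) <->
      (exists t, st (run prog blank start input inA inB t) = halt)].
Proof.
have [rs rsE] := machine_rules prog blank start halt input.
set n := size (nets Q R G).
exists (flatten (map int_word
  ([:: (2 * n.+2)%N%:Z; (2 * 4)%N%:Z; (2 * height rs)%N%:Z]
   ++ map (network_config (layout n rs))
          (box (2 * n.+2) (2 * 4) (2 * height rs))))), n.+2.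
move=> inA inB.
exists (machine_encoding Q R G rs inA inB), (machine_sandpile Q R G rs inA inB).
split; [exact: machine_encodes rsE _ _| | exact: machine_prediction rsE _ _].
rewrite /encoding_word /encoding_fields catA map_cat flatten_cat; congr cat.
have s0 : seed_vertex Q R G 1 0 = (2%:Z, 0, 0) by rewrite /seed_vertex muln0 addn0.
rewrite /machine_encoding /added_chips /seed_vertices s0 /seed_vertex -/n.
move: (2 * (2 + n.+2 * inA))%N (2 * (3 + n.+2 * inB))%N => X Y.
by rewrite /seed_word /= /int_word -!cats1 -!catA.
Qed.

(** * The diagonal machine *)

Definition digit (a : letter) : nat :=
  match a with Tally => 0 | Minus => 1 | Sep => 2 end.

(* Bijective base 3, least significant digit first. *)
Fixpoint word_code (w : seq letter) : nat :=
  if w is a :: w' then (digit a + 3 * word_code w').+1 else 0%N.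

Section Program.

Variable M : turing_machine letter.

Notation Q := ('I_60 + state M)%type.
Notation R := 'I_5.
Notation G := (symbol M).

Definition rA : R := @Ordinal 5 0 isT.
Definition rB : R := @Ordinal 5 1 isT.
Definition rC : R := @Ordinal 5 2 isT.
Definition rD : R := @Ordinal 5 3 isT.
Definition rE : R := @Ordinal 5 4 isT.

Definition regs (a b c d e : nat) : R -> nat := fun r => nth 0%N [:: a; b; c; d; e] r.

(* [A = C] hold the code of the background and [D = E] half its period. *)
Definition program_input : R -> option bool :=
  fun r => nth None [:: Some false; None; Some false; Some true; Some true] r.

(** The printing program has 53 instructions, within the bound 60; [inord] sends labels from 60 on
    to 0. *)
Definition label (k : nat) : Q := inl (inord k).

Notation inc := (@IInc Q R G).
Notation dec := (@IDec Q R G).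

Definition write (a : letter) (k : nat) : instr Q R G :=
  ITape R (fun _ => (label k, Defs.input M a, MoveRight)).

Definition write_all (l : seq letter) (k : nat) : seq (instr Q R G) :=
  [seq write a.2 (k + a.1).+1 | a <- zip (iota 0 (size l)) l].

(* Prints [2 * o * d] tallies, where [o] is in register [O] and [d] in [rD]. *)
Definition multiply (O : R) (p : nat) : seq (instr Q R G) :=
  [:: dec O (label (p + 1)) (label (p + 7));
      dec rD (label (p + 2)) (label (p + 5));
      write Tally (p + 3); write Tally (p + 4); inc rB (label (p + 1));
      dec rB (label (p + 6)) (label p);
      inc rD (label (p + 5))].

(** The literal parts of the printed word. The tallies ending [text1] and [text2] are the constant
    parts [2 * 2] and [2 * 3] of the next seed position; the product with the period is printed
    right after them. *)
Definition text1 : seq letter :=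
  [:: Tally; Tally; Sep; Sep; Sep; Tally; Sep; Tally; Tally; Tally; Tally].
Definition text2 : seq letter :=
  [:: Sep; Sep; Sep; Tally; Sep; Tally; Tally; Tally; Tally; Tally; Tally].
Definition text3 : seq letter := [:: Sep; Sep; Sep; Tally; Sep].

(** One round per letter: after the successor is removed, [rA] is divided by 3. The remainder
    selects the letter, and the quotient is collected in [rB] and moved back. *)
Definition decode : seq (instr Q R G) :=
  [:: dec rA (label 1) (label 10);
      dec rA (label 2) (label 5);
      dec rA (label 3) (label 6);
      dec rA (label 4) (label 7);
      inc rB (label 1);
      write Tally 8; write Minus 8; write Sep 8;
      dec rB (label 9) (label 0);
      inc rA (label 8)].

(** The printed word contains no blank, so the blank on its left marks where to turn. *)
Definition rewind : seq (instr Q R G) :=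
  [:: ITape R (fun a => (label 52, a, MoveLeft));
      ITape R (fun a => if a == blank M then (inr (start M), a, MoveRight)
                      else (label 52, a, MoveLeft))].

(* Jumps are absolute: the blocks start at 0, 10, 21, 28, 39, 46 and 51. *)
Definition code : seq (instr Q R G) :=
  decode ++ write_all text1 10 ++ multiply rC 21 ++ write_all text2 28
  ++ multiply rE 39 ++ write_all text3 46 ++ rewind.

Definition instruction (k : nat) : instr Q R G := nth (inc rA (label 0)) code k.

Definition simulate (q : state M) : instr Q R G :=
  ITape R (fun a =>
    if (q == accept M) || (q == reject M) then (inr q, a, MoveRight)
    else let: (q', b, d) := transition q a in (inr q', b, d)).

Definition program (q : Q) : instr Q R G :=
  match q with inl i => instruction i | inr q => simulate q end.

(** * Execution of the printing program *)

Definition reach (c c' : config Q R G) : Prop :=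
  exists t, iter t (mstep program) c = c'.

Lemma reach_refl c : reach c c. Proof. by exists 0%N. Qed.

Lemma reach_trans c1 c2 c3 : reach c1 c2 -> reach c2 c3 -> reach c1 c3.
Proof. by move=> [t <-] [t' <-]; exists (t' + t)%N; rewrite iterD. Qed.

Lemma reach_step c c' : mstep program c = c' -> reach c c'.
Proof. by move=> <-; exists 1%N. Qed.

Definition tape_of (s : seq letter) : int -> G :=
  fun x => if x is Posz k then nth (blank M) (map (Defs.input M) s) k else blank M.

Definition printing (k : nat) (g : R -> nat) (s : seq letter) : config Q R G :=
  Config (label k) g (tape_of s) (size s).

Lemma program_label k : (k < 60)%N -> program (label k) = instruction k.
Proof. by move=> k60; rewrite /= inordK. Qed.

Lemma upd_tape_of s a : upd (tape_of s) (size s) (Defs.input M a) = tape_of (rcons s a).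
Proof.
apply: funext => -[k|k]; rewrite /upd //=.
rewrite map_rcons nth_rcons size_map eqz_nat.
by case: ltngtP => // h; rewrite nth_default // size_map ltnW.
Qed.

Lemma reach_write k k' a g s : (k < 60)%N -> instruction k = write a k' ->
  reach (printing k g s) (printing k' g (rcons s a)).
Proof.
move=> k60 ik; apply: reach_step; rewrite /mstep /printing program_label // ik /=.
by rewrite upd_tape_of size_rcons -PoszD addn1.
Qed.

Lemma reach_inc k k' r g s : (k < 60)%N -> instruction k = inc r (label k') ->
  reach (printing k g s) (printing k' (upd g r (g r).+1) s).
Proof.
by move=> k60 ik; apply: reach_step; rewrite /mstep /printing program_label // ik.
Qed.

Lemma reach_dec k k' k0 r g s : (k < 60)%N ->
  instruction k = dec r (label k') (label k0) ->
  reach (printing k g s)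
    (if g r is j.+1 then printing k' (upd g r j) s else printing k0 g s).
Proof.
move=> k60 ik; apply: reach_step; rewrite /mstep /printing program_label // ik.
by case: (g r).
Qed.

Lemma reach_write_all l k g s : (k + size l < 60)%N ->
  (forall i, (i < size l)%N -> instruction (k + i) = write (nth Tally l i) (k + i).+1) ->
  reach (printing k g s) (printing (k + size l) g (s ++ l)).
Proof.
elim: l k s => [|a l IHl] k s kl h.
  by rewrite addn0 cats0; apply: reach_refl.
have h0 := h 0%N isT; rewrite addn0 in h0.
apply: reach_trans (reach_write _ _ _ h0) _; first by move: kl; rewrite /=; lia.
rewrite -cat_rcons -[(k + _)%N]addSnnS; apply: IHl; first by rewrite addSnnS.
by move=> i il; rewrite addSnnS; apply: (h i.+1).
Qed.

Section Multiply.

Variables (O : R) (p : nat) (f : nat -> nat -> nat -> R -> nat).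
Hypothesis p53 : (p + 7 < 60)%N.
Hypothesis block : forall i, (i < 7)%N ->
  instruction (p + i) = nth (inc rA (label 0)) (multiply O p) i.
Hypothesis fO : forall o b d, f o b d O = o.
Hypothesis fB : forall o b d, f o b d rB = b.
Hypothesis fD : forall o b d, f o b d rD = d.
Hypothesis updO : forall o b d o', upd (f o b d) O o' = f o' b d.
Hypothesis updB : forall o b d b', upd (f o b d) rB b' = f o b' d.
Hypothesis updD : forall o b d d', upd (f o b d) rD d' = f o b d'.

(** [f o b d] stands for the registers with [O], [rB], [rD] holding [o], [b], [d]; leaving it
    abstract serves both [rC] and [rE]. Moving a unit from [rD] to [rB] prints two tallies and keeps
    the factor for the next round. *)
Lemma multiply_inner o b d s :
  reach (printing (p + 1) (f o b d) s)
        (printing (p + 5) (f o (b + d) 0) (s ++ nseq (2 * d) Tally)).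
Proof.
elim: d b s => [|d IHd] b s.
  apply: reach_trans (reach_dec _ _ _ (@block 1 isT)) _; first by lia.
  by rewrite fD addn0 cats0; apply: reach_refl.
apply: reach_trans (reach_dec _ _ _ (@block 1 isT)) _; first by lia.
rewrite fD updD.
apply: reach_trans (reach_write _ _ _ (@block 2 isT)) _; first by lia.
apply: reach_trans (reach_write _ _ _ (@block 3 isT)) _; first by lia.
apply: reach_trans (reach_inc _ _ _ (@block 4 isT)) _; first by lia.
rewrite fB updB mulnS -[(b + d.+1)%N]addSnnS nseqD catA.
have -> : rcons (rcons s Tally) Tally = s ++ nseq 2 Tally.
  by rewrite -!cats1 -catA.
exact: IHd.
Qed.

Lemma multiply_restore o b d s :
  reach (printing (p + 5) (f o b d) s) (printing p (f o 0 (d + b)) s).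
Proof.
elim: b d => [|b IHb] d.
  apply: reach_trans (reach_dec _ _ _ (@block 5 isT)) _; first by lia.
  by rewrite fB addn0; apply: reach_refl.
apply: reach_trans (reach_dec _ _ _ (@block 5 isT)) _; first by lia.
rewrite fB updB.
apply: reach_trans (reach_inc _ _ _ (@block 6 isT)) _; first by lia.
by rewrite fD updD -[(d + b.+1)%N]addSnnS.
Qed.

Lemma reach_multiply o d s :
  reach (printing p (f o 0 d) s)
        (printing (p + 7) (f 0 0 d) (s ++ nseq (2 * (d * o)) Tally)).
Proof.
have b0 : instruction p = nth (inc rA (label 0)) (multiply O p) 0.
  by rewrite -block // addn0.
elim: o s => [|o IHo] s.
  apply: reach_trans (reach_dec _ _ _ b0) _; first by lia.
  by rewrite fO !muln0 cats0; apply: reach_refl.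
apply: reach_trans (reach_dec _ _ _ b0) _; first by lia.
rewrite fO updO.
apply: reach_trans (multiply_inner _ _ _ _) _.
apply: reach_trans (multiply_restore _ _ _ _) _.
by rewrite !add0n mulnS mulnDr nseqD catA.
Qed.

End Multiply.

Lemma upd_regs a b c d e :
  ((forall x, upd (regs a b c d e) rA x = regs x b c d e) *
   (forall x, upd (regs a b c d e) rB x = regs a x c d e) *
   (forall x, upd (regs a b c d e) rC x = regs a b x d e) *
   (forall x, upd (regs a b c d e) rD x = regs a b c x e) *
   (forall x, upd (regs a b c d e) rE x = regs a b c d x))%type.
Proof.
by split; [split; [split; [split|]|]|]; move=> x;
  apply: funext => -[[|[|[|[|[|]]]]] ?].
Qed.

Lemma decode_letter a m b c d e s :
  reach (printing 1 (regs (digit a + 3 * m) b c d e) s)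
        (printing 8 (regs 0 (b + m) c d e) (rcons s a)).
Proof.
elim: m b => [|m IHm] b.
  rewrite muln0 !addn0; case: a => /=.
  - apply: reach_trans (reach_dec (k := 1) (r := rA) _ _ isT erefl) _ => /=.
    exact: (reach_write (k := 5) _ _ isT erefl).
  - apply: reach_trans (reach_dec (k := 1) (r := rA) _ _ isT erefl) _ => /=.
    rewrite upd_regs.
    apply: reach_trans (reach_dec (k := 2) (r := rA) _ _ isT erefl) _ => /=.
    exact: (reach_write (k := 6) _ _ isT erefl).
  - apply: reach_trans (reach_dec (k := 1) (r := rA) _ _ isT erefl) _ => /=.
    rewrite upd_regs.
    apply: reach_trans (reach_dec (k := 2) (r := rA) _ _ isT erefl) _ => /=.
    rewrite upd_regs.
    apply: reach_trans (reach_dec (k := 3) (r := rA) _ _ isT erefl) _ => /=.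
    exact: (reach_write (k := 7) _ _ isT erefl).
rewrite (_ : (digit a + 3 * m.+1)%N = (digit a + 3 * m).+3); last by lia.
apply: reach_trans (reach_dec (k := 1) (r := rA) _ _ isT erefl) _ => /=.
rewrite upd_regs.
apply: reach_trans (reach_dec (k := 2) (r := rA) _ _ isT erefl) _ => /=.
rewrite upd_regs.
apply: reach_trans (reach_dec (k := 3) (r := rA) _ _ isT erefl) _ => /=.
rewrite upd_regs.
apply: reach_trans (reach_inc (k := 4) (r := rB) _ _ isT erefl) _ => /=.
rewrite upd_regs.
by rewrite -[(b + m.+1)%N]addSnnS.
Qed.

Lemma decode_copy a b c d e s :
  reach (printing 8 (regs a b c d e) s) (printing 0 (regs (a + b) 0 c d e) s).
Proof.
elim: b a => [|b IHb] a.
  rewrite addn0; exact: (reach_dec (k := 8) (r := rB) _ _ isT erefl).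
apply: reach_trans (reach_dec (k := 8) (r := rB) _ _ isT erefl) _ => /=.
rewrite upd_regs.
apply: reach_trans (reach_inc (k := 9) (r := rA) _ _ isT erefl) _ => /=.
rewrite upd_regs.
by rewrite -[(a + b.+1)%N]addSnnS.
Qed.

Lemma reach_decode w c d e s :
  reach (printing 0 (regs (word_code w) 0 c d e) s)
        (printing 10 (regs 0 0 c d e) (s ++ w)).
Proof.
elim: w s => [|a w IHw] s.
  rewrite cats0; exact: (reach_dec (k := 0) (r := rA) _ _ isT erefl).
apply: reach_trans (reach_dec (k := 0) (r := rA) _ _ isT erefl) _.
rewrite (_ : regs _ _ _ _ _ rA = (digit a + 3 * word_code w).+1) // upd_regs.
apply: reach_trans (decode_letter _ _ _ _ _ _ _) _.
apply: reach_trans (decode_copy _ _ _ _ _ _) _.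
by rewrite !add0n -cat_rcons.
Qed.

Definition written (w : seq letter) (c : nat) : seq letter :=
  w ++ seed_word 2 ++ seed_word (2 * (2 + c * word_code w))
    ++ seed_word (2 * (3 + c * c)).

Lemma reach_written w c :
  reach (printing 0 (regs (word_code w) 0 (word_code w) c c) [::])
        (printing 51 (regs 0 0 0 c 0) (written w c)).
Proof.
apply: reach_trans (reach_decode _ _ _ _ _) _; rewrite cat0s.
apply: reach_trans (@reach_write_all text1 10 _ _ isT _) _.
  by do 11!case=> [//|].
apply: reach_trans (@reach_multiply rC 21 (fun o b d => regs 0 b o d c) isT _ _ _ _ _ _ _
   _ _ _) _; try by move=> *; rewrite ?upd_regs.
  by do 7!case=> [//|].
apply: reach_trans (@reach_write_all text2 28 _ _ isT _) _.
  by do 11!case=> [//|].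
apply: reach_trans (@reach_multiply rE 39 (fun o b d => regs 0 b 0 d o) isT _ _ _ _ _ _ _
   _ _ _) _; try by move=> *; rewrite ?upd_regs.
  by do 7!case=> [//|].
have -> : written w c = ((((w ++ text1) ++ nseq (2 * (c * word_code w)) Tally)
    ++ text2) ++ nseq (2 * (c * c)) Tally) ++ text3.
  by rewrite /written /seed_word !mulnDr !nseqD -!catA.
by apply: (@reach_write_all text3 46 _ _ isT _); do 5!case=> [//|].
Qed.

Lemma upd_id (t : int -> G) h : upd t h (t h) = t.
Proof. by apply: funext => x; rewrite /upd; case: eqP => [->|]. Qed.

Lemma reach_rewind g s :
  reach (printing 51 g s) (Config (inr (start M)) g (tape_of s) 0).
Proof.
(* For [k = 0] the head stands at -1, on the blank where the machine turns. *)
have left k : (k <= size s)%N ->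
    reach (Config (label 52) g (tape_of s) (k%:Z - 1))
         (Config (inr (start M)) g (tape_of s) 0).
  elim: k => [|k IHk] ks.
    apply: reach_step; rewrite /mstep program_label //= eqxx.
    by rewrite (_ : blank M = tape_of s (-1)) // upd_id.
  apply: reach_trans (IHk (ltnW ks)); apply: reach_step.
  have tk : (tape_of s k == blank M) = false.
    by rewrite /= (nth_map Tally) // (negPf (Defs.input_nonblank _ _)).
  have -> : k.+1%:Z - 1 = k%:Z by lia.
  rewrite /mstep program_label //.
  have -> : instruction 52 = ITape R (fun a =>
      if a == blank M then (inr (start M), a, MoveRight)
      else (label 52, a, MoveLeft)) by [].
  by rewrite tk upd_id.
apply: reach_trans (left _ (leqnn _)); apply: reach_step.
by rewrite /mstep /printing program_label //= (upd_id (tape_of s) (size s)).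
Qed.

(* The tapes need not agree once [M] has halted, since the simulating machine
   then keeps moving right. *)
Definition simulates (c : tm_config M) (d : config Q R G) : Prop :=
  st d = inr (current c) /\
  (current c != accept M -> current c != reject M ->
   (forall i : nat,
      tp d (hd d + i%:Z) = nth (blank M) (tape_head c :: tape_right c) i) /\
   (forall i : nat, tp d (hd d - 1 - i%:Z) = nth (blank M) (tape_left c) i)).

Lemma simulates_step c d : simulates c d -> simulates (step c) (mstep program d).
Proof.
case: c d => [q l a r] [q' g t h] [/= -> sim]; rewrite /mstep /= /simulate.
case: ifP => [halted|running].
  split=> //= qa qr; move: halted; rewrite (negPf qa) (negPf qr) //.
have /norP[qa qr] := negbT running; have [right left] := sim qa qr.
have th : t h = a by have := right 0%N; rewrite addr0.
rewrite th; case: (transition q a) => [[q1 b] []]; split=> //= _ _; split=> i.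
- case: i => [|i].
    rewrite addr0 /upd /= (_ : (h - 1 == h) = false); last by lia.
    by have := left 0%N; rewrite subr0; case: (l).
  rewrite (_ : h - 1 + i.+1%:Z = h + i%:Z); last by lia.
  rewrite /upd; case: i => [|i]; first by rewrite addr0 eqxx.
  rewrite (_ : (h + i.+1%:Z == h) = false); last by lia.
  by rewrite right.
- rewrite /upd (_ : (h - 1 - 1 - i%:Z == h) = false); last by lia.
  have := left i.+1; rewrite (_ : h - 1 - i.+1%:Z = h - 1 - 1 - i%:Z) //; last by lia.
  by rewrite nth_behead.
- rewrite /upd (_ : (h + 1 + i%:Z == h) = false); last by lia.
  have := right i.+1; rewrite (_ : h + i.+1%:Z = h + 1 + i%:Z); last by lia.
  by move=> ->; case: i => [|i] /=; [rewrite nth0 | rewrite nth_behead].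
- rewrite /upd (_ : h + 1 - 1 - i%:Z = h - i%:Z); last by lia.
  case: i => [|i]; first by rewrite subr0 eqxx.
  rewrite (_ : (h - i.+1%:Z == h) = false); last by lia.
  by have := left i; rewrite (_ : h - i.+1%:Z = h - 1 - i%:Z) //; lia.
Qed.

Lemma simulates_initial g s :
  simulates (initial M s) (Config (inr (start M)) g (tape_of s) 0).
Proof.
split=> // _ _; split=> i.
  rewrite -[LHS]/(tape_of s (0 + i%:Z)) add0r /=; case: s => [|a s]; last by case: i.
  by rewrite /= nth_nil; case: i => [//|i]; rewrite /= nth_nil.
rewrite -[LHS]/(tape_of s (0 - 1 - i%:Z)) (_ : 0 - 1 - i%:Z = Negz i); last by lia.
by rewrite nth_nil.
Qed.

Lemma simulates_iter c d k : simulates c d ->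
  simulates (iter k (@step letter M) c) (iter k (mstep program) d).
Proof. by move=> sim; elim: k => //= k; apply: simulates_step. Qed.

Lemma halting_run_rejects w c :
  (exists t, st (run program (blank M) (label 0) program_input (word_code w) c t)
             = inr (reject M)) <->
  rejects M (written w c).
Proof.
have [K runK] : reach
    (initial_config (blank M) (label 0) program_input (word_code w) c)
    (Config (inr (start M)) (regs 0 0 0 c 0) (tape_of (written w c)) 0).
  apply: reach_trans (reach_rewind _ _); apply: reach_trans (reach_written _ _).
  rewrite /initial_config /printing.
  have -> : tape_of [::] = (fun _ => blank M).
    by apply: funext => -[k|k] //=; rewrite nth_nil.
  have -> : regs (word_code w) 0 (word_code w) c c = (fun r =>
      match program_input r with
      | None => 0%N | Some false => word_code w | Some true => c end).
    by apply: funext => -[[|[|[|[|[|]]]]] ?].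
  exact: reach_refl.
have sim k : st (run program (blank M) (label 0) program_input (word_code w) c (k + K))
    = inr (current (iter k (@step letter M) (initial M (written w c)))).
  rewrite /run iterD runK.
  by have [] := simulates_iter k (simulates_initial (regs 0 0 0 c 0) (written w c)).
split=> [[t ht]|[k hk]]; last by exists (k + K)%N; rewrite sim hk.
(* The rejecting state is absorbing, so rejection at time [t] persists until [t + K], when the
   simulation of [M] has made [t] steps; this covers [t < K] as well. *)
exists t; suff: @inr 'I_60 _ (reject M) =
    inr (current (iter t (@step letter M) (initial M (written w c)))) by case.
rewrite -sim addnC; elim: K {runK sim} => [//|K IHK].
rewrite addSn /run iterS -/(run _ _ _ _ _ _ _); move: IHK.
case: (run _ _ _ _ _ _ _) => q g t' h /= <-.
by rewrite /mstep /= /simulate eqxx orbT.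
Qed.

End Program.

Lemma halted_stays (M : turing_machine letter) c i :
  (current c == accept M) || (current c == reject M) ->
  current (iter i (@step letter M) c) = current c.
Proof.
move=> halted; elim: i => [//|i IHi] /=.
by case: (iter i _ c) IHi => q l a r /= ->; rewrite halted.
Qed.

Lemma not_accepts_and_rejects (M : turing_machine letter) w :
  accepts M w -> rejects M w -> False.
Proof.
move=> [m am] [k rk].
have := @halted_stays M _ k (introT orP (or_introl (introT eqP am))).
rewrite -iterD addnC iterD halted_stays rk ?eqxx ?orbT // am => e.
by have := accept_neq_reject M; rewrite e eqxx.
Qed.

Theorem theorem2 :
  ~ exists M : turing_machine letter, decides_vertex_prediction M.
Proof.
move=> [M decM].
have [w [c sp]] := sandpile_of_machine (@program M) (blank M) (label M 0)
  (inr (reject M)) program_input.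
(* The diagonal choice: on these inputs the word that the machine prints encodes the very sandpile
   that runs it. *)
have [e [S0 [eS eW pred]]] := sp (word_code w) c.
have {}eW : encoding_word e = written w c by [].
have [hal acc] := decM e S0 eS.
(* Acceptance says that the origin topples, which happens exactly if the simulated [M] rejects the
   same word. *)
have rej : accepts M (encoding_word e) <-> rejects M (encoding_word e).
  by rewrite acc pred eW; apply: halting_run_rejects.
case: hal => h; apply: (not_accepts_and_rejects (M := M) (w := encoding_word e)) => //.
  exact/rej.
exact/rej.
Qed.
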